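(* Let $$G=\{g\in SL(4,\mathbb R)\mid g[e_3]=[e_3],\ {}^tg^{-1}[e_3]=[e_3]\}=\left\{\begin{pmatrix}*&*&0&*\\ *&*&0&*\\ 0&0&*&0\\ *&*&0&*\end{pmatrix}\in SL(4,\mathbb R)\right\}.$$ Then the double fibration $$G/(G\cap H_4)\ \longleftarrow\ G/(G\cap H)\ \longrightarrow\ G/(G\cap\overline H_1)$$ (natural projections) constructed from $G$ is the following fibration of compact type: $$G/(G\cap H_4)\cong \mathbb{R}P^2,\qquad G/(G\cap H)\cong\mathbb F_{V^3}(1,2),\qquad G/(G\cap\overline H_1)\cong \mathbb{R}P^2,$$ where the fiber of the left projection is $(G\cap H_4)/(G\cap H)\cong S^1$ and the fiber of the right projection is $(G\cap\overline H_1)/(G\cap H)\cong S^1$.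
   Context: $e_1,\dots,e_4$ is the standard basis of $\mathbb R^4$ and $[e_i]\in\mathbb RP^3$ the corresponding points. $H_i=\{g\in SL(4,\mathbb R)\mid g[e_i]=[e_i]\}$, $\overline H_i=\{g\in SL(4,\mathbb R)\mid {}^tg^{-1}[e_i]=[e_i]\}$, and $H=H_4\cap\overline H_1$. $V^3$ is a $3$-dimensional real vector space and $\mathbb F_{V^3}(1,2)$ is the flag manifold of pairs $(l,E)$ with $l\subset E\subset V^3$, $\dim l=1$, $\dim E=2$. $\cong$ denotes diffeomorphism; ''compact type'' refers to the spaces in the double fibration being compact. *)

(* Defs.v *)
From HB Require Import structures.
From mathcomp Require Import all_boot all_order all_algebra.
From mathcomp Require Import all_classical all_reals all_analysis.

Set Implicit Arguments.
Unset Strict Implicit.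
Unset Printing Implicit Defensive.

Import Order.TTheory GRing.Theory Num.Theory.
Import numFieldNormedType.Exports.

Local Open Scope classical_set_scope.
Local Open Scope ring_scope.

(* For finite-dimensional [E] and open [U] this is the usual C^k: [f] is
   C^(k+1) on [U] iff it is differentiable there and all its directional
   derivatives are C^k on [U].  The values of [f] outside [U] are irrelevant. *)
Fixpoint Ck (R : realType) (E : normedModType R) (k : nat) (U : set E)
    (f : E -> R) : Prop :=
  if k is k'.+1 then
    (forall x, U x -> differentiable f x) /\
    (forall v : E, Ck k' U (fun x => 'D_v f x))
  else forall x, U x -> {for x, continuous f}.

Definition Coo (R : realType) (E : normedModType R) (U : set E) (f : E -> R) :=
  forall k, Ck k U f.

Lemma near_eq_continuous (T Y : topologicalType) (f g : T -> Y) (x : T) :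
  (\near x, f x = g x) -> {for x, continuous f} -> {for x, continuous g}.
Proof.
move=> fg cf; rewrite /prop_for /continuous_at -(nbhs_singleton fg).
by apply: cvg_trans cf; exact: near_eq_cvg.
Qed.

Section CkTheory.
Variables (R : realType) (E : normedModType R).
Implicit Types (U : set E) (f g : E -> R).

Lemma near_eq_differentiable f g x :
  (\near x, f x = g x) -> differentiable f x -> differentiable g x.
Proof.
move=> fg df.
have gx : f x = g x := nbhs_singleton fg.
have H : g \o shift x = cst (g x) + 'd f x +o_ 0 id.
  apply/eqaddoP => e e0; have /eqaddoP/(_ e e0) := diff_locally df.
  have fg0 : \forall h \near (0 : E), f (h + x) = g (h + x).
    by have := fg; rewrite (near_shift 0) /= subr0; apply: filterS.
  by apply: filterS2 fg0 => h /= fgh; rewrite !fctE /= -fgh -gx.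
have dfc : continuous ('d f x) by exact: diff_continuous.
have E1 := diff_unique dfc H.
by apply/diff_locallyP; rewrite E1.
Qed.

Lemma Ck_ext k U f g : open U -> (forall x, U x -> f x = g x) ->
  Ck k U f -> Ck k U g.
Proof.
move=> oU; elim: k f g => [|k IH] f g fg /=.
- move=> cf x Ux; apply: near_eq_continuous (cf _ Ux).
  by apply: filterS (open_nbhs_nbhs (conj oU Ux)) => y /fg.
- case=> df dv.
  have fgx x : U x -> \near x, f x = g x.
    by move=> Ux; apply: filterS (open_nbhs_nbhs (conj oU Ux)) => y /fg.
  split=> [x Ux|v]; first by apply: near_eq_differentiable (df _ Ux); exact: fgx.
  have [->|v0] := eqVneq v 0.
    apply: IH (dv 0) => x Ux; by rewrite !derive0.
  by apply: IH (dv v) => x Ux; apply: near_eq_derive => //; exact: fgx.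
Qed.

Lemma Ck_sub k U W f : W `<=` U -> Ck k U f -> Ck k W f.
Proof.
move=> WU; elim: k f => [|k IH] f /=; first by move=> cf x /WU; exact: cf.
by case=> df dv; split=> [x /WU|v]; [exact: df|exact: IH].
Qed.

Lemma Ck_local k U f :
  (forall x, U x -> exists W, [/\ W x & Ck k W f]) -> Ck k U f.
Proof.
elim: k f => [|k IH] f H /=.
  by move=> x /H[W [Wx /= cf]]; exact: cf.
split=> [x /H[W [Wx /= [df _]]]|v]; first exact: df.
by apply: IH => x /H[W [Wx /= [_ dv]]]; exists W.
Qed.

Lemma CkW k U f : Ck k.+1 U f -> Ck k U f.
Proof.
elim: k f => [|k IH] f [df dv] /=.
  by move=> x Ux; apply: differentiable_continuous; exact: df.
by split=> // v; exact: IH.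
Qed.

Lemma Ck_cst k U c : Ck k U (cst c).
Proof.
elim: k c => [|k IH] c /=; first by move=> x _; exact: cst_continuous.
split=> [x _|v]; first exact: differentiable_cst.
rewrite (_ : (fun x => _) = cst 0); first exact: IH.
by apply/funext => x; rewrite derive_cst.
Qed.

Lemma CkD k U f g : open U -> Ck k U f -> Ck k U g -> Ck k U (f \+ g).
Proof.
move=> oU; elim: k f g => [|k IH] f g /=.
  by move=> cf cg x Ux; apply: continuousD; [exact: cf|exact: cg].
case=> df dvf [dg dvg]; split=> [x Ux|v].
  by apply: differentiableD; [exact: df|exact: dg].
apply: Ck_ext (IH _ _ (dvf v) (dvg v)) => // x Ux /=.
by rewrite -deriveD //; apply: diff_derivable; [exact: df|exact: dg].
Qed.

Lemma CkM k U f g : open U -> Ck k U f -> Ck k U g -> Ck k U (f \* g).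
Proof.
move=> oU; elim: k f g => [|k IH] f g.
  by move=> cf cg x Ux; apply: continuousM; [exact: cf|exact: cg].
move=> cf cg; have [df dvf] := cf; have [dg dvg] := cg.
split=> [x Ux|v].
  by apply: differentiableM; [exact: df|exact: dg].
have := CkD oU (IH _ _ (CkW cf) (dvg v)) (IH _ _ (CkW cg) (dvf v)).
apply: Ck_ext => // x Ux /=.
by rewrite -[RHS]/('D_v (f * g) x) deriveM //; apply: diff_derivable;
  [exact: df|exact: dg].
Qed.

End CkTheory.

(* A functionally structured space (Bredon, Topology and Geometry, II.2): a
   topological space with, for each open [U], an algebra of continuous
   functions on [U] (the smooth ones), these algebras forming a sheaf.  A
   smooth manifold is such a space, its functional structure being the sheaf of
   C^oo functions.  A function on [U] is encoded as a total function whose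
   values outside [U] are ignored ([smooth_on_ext]). *)
Record smooth_space (R : realType) := SmoothSpace {
  smooth_sort :> topologicalType;
  smooth_on : set smooth_sort -> (smooth_sort -> R) -> Prop;
  smooth_on_continuous : forall U f, open U -> smooth_on U f ->
    forall x, U x -> {for x, continuous f};
  smooth_on_ext : forall U f g, open U -> (forall x, U x -> f x = g x) ->
    smooth_on U f -> smooth_on U g;
  smooth_on_cst : forall U c, open U -> smooth_on U (cst c);
  smooth_onD : forall U f g, open U -> smooth_on U f -> smooth_on U g ->
    smooth_on U (f \+ g);
  smooth_onM : forall U f g, open U -> smooth_on U f -> smooth_on U g ->
    smooth_on U (f \* g);
  smooth_on_sub : forall U W f, open U -> open W -> W `<=` U ->
    smooth_on U f -> smooth_on W f;
  smooth_on_glue : forall U f, open U ->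
    (forall x, U x -> exists W, [/\ open W, W x & smooth_on W f]) ->
    smooth_on U f
}.

Section SmoothMaps.
Variable R : realType.
Implicit Types X Y : smooth_space R.

Definition smooth_map X Y (phi : X -> Y) : Prop :=
  continuous phi /\
  forall (U : set Y) (f : Y -> R), open U -> smooth_on U f ->
    smooth_on (phi @^-1` U) (f \o phi).

Definition diffeomorphism X Y (phi : X -> Y) : Prop :=
  exists psi : Y -> X,
    [/\ cancel phi psi, cancel psi phi, smooth_map phi & smooth_map psi].

Definition diffeomorphic X Y : Prop := exists phi : X -> Y, diffeomorphism phi.

End SmoothMaps.

Section Euclid.
Variables (R : realType) (E : normedModType R).

Definition euclid : smooth_space R.
Proof.
refine (@SmoothSpace R E (@Coo R E) _ _ _ _ _ _ _).
- by move=> U f _ /(_ 0).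
- by move=> U f g oU fg cf k; apply: Ck_ext (cf k).
- by move=> U c _ k; exact: Ck_cst.
- by move=> U f g oU cf cg k; exact: CkD.
- by move=> U f g oU cf cg k; exact: CkM.
- by move=> U W f _ _ WU cf k; exact: Ck_sub (cf k).
- move=> U f _ H k; apply: Ck_local => x /H[W [_ Wx cf]].
  by exists W; split=> //; exact: cf.
Defined.

End Euclid.

Section Subspace.
Variables (R : realType) (X : smooth_space R) (A : set X).

(* Functions that locally extend to smooth functions on [X]. *)
Definition sub_smooth_on (U : set A) (f : A -> R) : Prop :=
  forall x : A, U x -> exists (W : set X) (F : X -> R),
    [/\ open W, W (set_val x), smooth_on W F &
        forall y : A, U y -> W (set_val y) -> f y = F (set_val y)].

Let val_cont : continuous (set_val : A -> X).
Proof. exact: initial_continuous. Qed.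

Definition sub_space : smooth_space R.
Proof.
refine (@SmoothSpace R A sub_smooth_on _ _ _ _ _ _ _).
- move=> U f oU sf x Ux; have [W [F [oW Wx sF fF]]] := sf x Ux.
  have oW' : open (set_val @^-1` W : set A).
    by exists W.
  have cF : {for x, continuous (F \o (set_val : A -> X))}.
    exact: continuous_comp (@val_cont x) (smooth_on_continuous oW sF Wx).
  have nx := open_nbhs_nbhs (conj (openI oU oW') (conj Ux Wx : (_ `&` _) x)).
  by apply: near_eq_continuous cF; apply: filterS nx => y [Uy Wy] /=; rewrite fF.
- move=> U f g oU fg sf x Ux; have [W [F [oW Wx sF fF]]] := sf x Ux.
  by exists W, F; split=> // y Uy Wy; rewrite -fg // fF.
- move=> U c oU x Ux; exists setT, (cst c); split=> //; first exact: openT.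
  by apply: smooth_on_cst; exact: openT.
- move=> U f g oU sf sg x Ux.
  have [W [F [oW Wx sF fF]]] := sf x Ux.
  have [W' [F' [oW' Wx' sF' fF']]] := sg x Ux.
  have oWW := openI oW oW'.
  exists (W `&` W'), (F \+ F'); split=> //.
    apply: smooth_onD => //.
      by apply: smooth_on_sub sF => // z [].
    by apply: smooth_on_sub sF' => // z [].
  by move=> y Uy [Wy Wy'] /=; rewrite fF // fF'.
- move=> U f g oU sf sg x Ux.
  have [W [F [oW Wx sF fF]]] := sf x Ux.
  have [W' [F' [oW' Wx' sF' fF']]] := sg x Ux.
  have oWW := openI oW oW'.
  exists (W `&` W'), (F \* F'); split=> //.
    apply: smooth_onM => //.
      by apply: smooth_on_sub sF => // z [].
    by apply: smooth_on_sub sF' => // z [].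
  by move=> y Uy [Wy Wy'] /=; rewrite fF // fF'.
- move=> U W f _ _ WU sf x Wx; have [Z [F [oZ Zx sF fF]]] := sf x (WU _ Wx).
  by exists Z, F; split=> // y /WU; exact: fF.
- move=> U f oU H x Ux; have [Z [oZ Zx sf]] := H x Ux.
  have [W [F [oW Wx sF fF]]] := sf x Zx.
  case: oZ Zx fF {sf} => Z' oZ' <- /= Z'x fF.
  exists (W `&` Z'), F; split=> //; first exact: openI.
    by apply: (smooth_on_sub oW _ _ sF); [exact: openI|move=> ? []].
  by move=> y _ [Wy Z'y]; exact: fF.
Defined.

End Subspace.

Definition fiber (R : realType) (X Y : smooth_space R) (p : X -> Y) (y : Y) :
  smooth_space R := sub_space (p @^-1` [set y]).

(* The final (quotient) topology on [T] along [q : X -> T]. *)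
Definition final_topology (X T : Type) (q : X -> T) : Type := T.

Section FinalTopology.
Variables (X : topologicalType) (T : choiceType) (q : X -> T).

Definition final_open (U : set T) : Prop := open (q @^-1` U).

Let final_openT : final_open setT. Proof. exact: openT. Qed.

Let final_openI : setI_closed final_open.
Proof. by move=> A B; exact: openI. Qed.

Let final_open_bigU (I : Type) (g : I -> set T) :
  (forall i, final_open (g i)) -> final_open (\bigcup_i g i).
Proof. by move=> og; apply: bigcup_open => i _; exact: og. Qed.

HB.instance Definition _ := Choice.on (final_topology q).
HB.instance Definition _ := isOpenTopological.Build (final_topology q)
  final_openT final_openI final_open_bigU.

Lemma final_continuous : continuous (q : X -> final_topology q).
Proof. by apply/continuousP => U. Qed.

End FinalTopology.

Section Quotient.
Variables (R : realType) (X : smooth_space R) (T : choiceType) (q : X -> T).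

(* When [q] is (isomorphic to) a surjective submersion of manifolds [X -> T],
   this is the manifold structure of [T]. *)
Definition quot_smooth_on (U : set (final_topology q))
    (f : final_topology q -> R) : Prop := smooth_on (q @^-1` U) (f \o q).

Definition quot_space : smooth_space R.
Proof.
refine (@SmoothSpace R (final_topology q) quot_smooth_on _ _ _ _ _ _ _).
- move=> U f oU sf t Ut V /=; rewrite nbhsE => -[V' [oV' V'ft] V'V].
  have oq : open (q @^-1` (U `&` f @^-1` V')).
    rewrite openE => x [/= Ux V'x].
    have := @smooth_on_continuous _ _ _ _ (oU : open (q @^-1` U)) sf x Ux.
    move=> /(_ V' (open_nbhs_nbhs (conj oV' V'x))) nV.
    have nU := open_nbhs_nbhs (conj (oU : open (q @^-1` U)) (Ux : (q @^-1` U) x)).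
    exact: filterI nU nV.
  have nt := open_nbhs_nbhs (conj (oq : open (U `&` f @^-1` V'))
    (conj Ut V'ft : (_ `&` _) t)).
  have: nbhs t (f @^-1` V) by apply: filterS nt => s [_ /V'V].
  by [].
- by move=> U f g oU fg; apply: smooth_on_ext => // x Ux; exact: fg.
- by move=> U c oU; exact: smooth_on_cst.
- by move=> U f g oU; exact: smooth_onD.
- by move=> U f g oU; exact: smooth_onM.
- by move=> U W f oU oW WU; apply: smooth_on_sub => // x; exact: WU.
- move=> U f oU H; apply: smooth_on_glue => // x Ux.
  by have [W [oW Wx sf]] := H _ Ux; exists (q @^-1` W).
Defined.

End Quotient.

Section HomogeneousSpaces.
Variables (R : realType) (n : nat).
Implicit Types G K L : set 'M[R]_n.

Definition lcoset_mx (g : 'M[R]_n) K : set 'M[R]_n := [set g *m k | k in K].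

Definition cosets G K : set (set 'M[R]_n) := [set lcoset_mx g K | g in G].

Definition to_coset G K (g : G) : cosets G K :=
  SigSub (mem_set (ex_intro2 _ _ (set_val g) (set_mem (valP g)) erefl)
          : lcoset_mx (set_val g) K \in cosets G K).

(* [G] carries the structure of a submanifold of the space of matrices, and
   [G / K] the quotient structure; for closed subgroups [K `<=` G] of [GL_n]
   these are the usual manifold structures. *)
Definition hom_space G K : smooth_space R :=
  quot_space (X := sub_space (G : set (euclid 'M[R]_n))) (@to_coset G K).

Lemma cosetsP G K (C : hom_space G K) : exists g : G, to_coset K g = C.
Proof.
case: C => C CG; have [g Gg gC] := set_mem CG.
by exists (SigSub (mem_set Gg)); apply/val_inj.
Qed.

(* The natural projection [g K |-> g L]; for groups [K `<=` L] it does not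
   depend on the choice of [g], see [hom_projE]. *)
Definition hom_proj G K L (C : hom_space G K) : hom_space G L :=
  to_coset L (projT1 (cid (cosetsP C))).

Definition is_mx_group K : Prop :=
  [/\ K 1%:M, forall g h, K g -> K h -> K (g *m h) &
      forall g, K g -> g \in unitmx /\ K (invmx g)].

Lemma hom_projE G K L (g : G) : is_mx_group K -> is_mx_group L -> K `<=` L ->
  hom_proj L (to_coset K g : hom_space G K) = to_coset L g.
Proof.
move=> [K1 _ _] [_ LM LV] KL; rewrite /hom_proj; case: cid => g' /= /(congr1 val) /= E.
apply/val_inj => /=.
have [k Kk <-] : lcoset_mx (set_val g) K (set_val g').
  by rewrite -E; exists 1%:M => //; rewrite mulmx1.
have [ku Lk'] := LV _ (KL _ Kk).
apply/seteqP; split=> _ [l Ll <-].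
  by exists (k *m l); [apply: LM => //; exact: KL|rewrite mulmxA].
exists (invmx k *m l); first exact: LM.
by rewrite mulmxA -[_ *m k *m _]mulmxA mulmxV // mulmx1.
Qed.

End HomogeneousSpaces.

Section Models.
Variable R : realType.

Definition line_set n : set {vspace 'cV[R]_n} := [set l | \dim l == 1%N].

Lemma line_subproof n (v : [set v : 'cV[R]_n | v != 0]) :
  <[set_val v]>%VS \in @line_set n.
Proof. by apply/mem_set; rewrite /line_set /= dim_vline; case: v => v /set_mem /= ->. Qed.

(* RP^n: the lines of R^(n+1), as the quotient of R^(n+1) minus 0. *)
Definition RP n : smooth_space R :=
  quot_space (X := sub_space ([set v | v != 0] : set (euclid 'cV[R]_n.+1)))
    (fun v => SigSub (line_subproof v) : @line_set n.+1).

Definition circle : smooth_space R :=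
  sub_space ([set v | v 0 0 ^+ 2 + v 0 1 ^+ 2 = 1] : set (euclid 'rV[R]_2)).

Section Flags.
Variable V : vectType R.

Definition flag_set : set ({vspace V} * {vspace V}) :=
  [set F | (F.1 <= F.2)%VS /\ (\dim F.1 = 1%N /\ \dim F.2 = 2)].

(* The vector of [V] with coordinates [x] in a basis of [V]; the smooth
   structure below does not depend on that basis. *)
Definition of_coord (x : 'rV[R]_(\dim {:V})) : V :=
  \sum_i x 0 i *: (vbasis {:V})`_i.

Definition frames : set ('rV[R]_(\dim {:V}) * 'rV[R]_(\dim {:V})) :=
  [set p | free [:: of_coord p.1; of_coord p.2]].

Lemma flag_subproof (p : frames) :
  (<[of_coord (set_val p).1]>%VS,
   <<[:: of_coord (set_val p).1; of_coord (set_val p).2]>>%VS) \in flag_set.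
Proof.
apply/mem_set; have fp : free [:: of_coord (set_val p).1; of_coord (set_val p).2].
  by have := set_mem (valP p).
split=> /=; first by rewrite span_cons addvSl.
split; last exact/eqP.
by rewrite dim_vline (free_not0 fp (mem_head _ _)).
Qed.

(* The flag manifold of pairs [l < E] with [\dim l = 1], [\dim E = 2], as the
   quotient of the open set of 2-frames [(a, b)] by
   [(a, b) |-> (<a>, <a, b>)]. *)
Definition flags : smooth_space R :=
  quot_space (X := sub_space (frames : set (euclid _)))
    (fun p => SigSub (flag_subproof p) : flag_set).

End Flags.

End Models.

Section Groups.
Variable R : realType.

(* The standard basis of R^4, numbered from 1. *)
Definition std (i : nat) : 'cV[R]_4 := \col_(j < 4) (j.+1 == i)%:R.

(* The point [v] of projective space, as a line; [g] acts by g[v] = [gv]. *)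
Definition proj_pt n (v : 'cV[R]_n) : {vspace 'cV[R]_n} := <[v]>%VS.

Definition SL4 : set 'M[R]_4 := [set g | \det g = 1].

(* [Hstab i] and [Hbar i] are the stabilizers of [e_i] under g and tg^-1. *)
Definition Hstab (i : nat) : set 'M[R]_4 :=
  [set g | SL4 g /\ proj_pt (g *m std i) = proj_pt (std i)].

Definition Hbar (i : nat) : set 'M[R]_4 :=
  [set g | SL4 g /\ proj_pt ((invmx g)^T *m std i) = proj_pt (std i)].

Definition Hflag : set 'M[R]_4 := Hstab 4 `&` Hbar 1.

Definition G3 : set 'M[R]_4 :=
  [set g | [/\ SL4 g, proj_pt (g *m std 3) = proj_pt (std 3) &
               proj_pt ((invmx g)^T *m std 3) = proj_pt (std 3)]].

End Groups.

Arguments SL4 {R}.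
Arguments Hstab {R} i.
Arguments Hbar {R} i.
Arguments Hflag {R}.
Arguments G3 {R}.

(* Main.v *)
Require Import Defs.
From HB Require Import structures.
From mathcomp Require Import all_boot all_order all_algebra.
From mathcomp Require Import perm ring.
From mathcomp Require Import all_classical all_reals all_analysis.

(* The block of rows and columns 1, 2, 4 identifies [G3] with GL_3, and turns
   [G / K4], [G / K1] and [G / K] into the orbit spaces of the line spanned by
   e_4, of the line spanned by e_1 under the contragredient action, and of the
   flag <e_4> < <e_4, e_2>.  A smooth map through which a quotient map lifts
   locally is itself a quotient map, and two quotient maps with the same fibres
   have diffeomorphic targets; so each diffeomorphism amounts to local lifts,
   obtained by varying some columns of an invertible matrix.  K4 / K and K1 / K
   are projective lines, which angle doubling identifies with the circle.  The
   fibres over arbitrary points are translates of these, a local section of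
   G -> G / K (the unipotent factor of U times lower triangular) providing the
   smooth inverse.  Compactness is that of O(3), by Gram-Schmidt. *)

Set Implicit Arguments.
Unset Strict Implicit.
Unset Printing Implicit Defensive.

Import Order.TTheory GRing.Theory Num.Theory.
Import numFieldNormedType.Exports.

Local Open Scope classical_set_scope.
Local Open Scope ring_scope.

(** * Germs of smooth functions *)

(** A [smooth_space] provides only constants, sums, products, restriction and gluing of smooth
    functions, whereas the proof divides by determinants and composes matrix-valued maps. Hence
    [comp_closed]: it holds for a normed space by the chain rule and passes to subspaces and to
    quotients, thus to every space met here. No charts occur; smoothness out of a quotient is tested
    upstairs, smoothness into a subspace in the ambient space. The delicate point is the fibres: a
    fibre is a subspace of a quotient, while K4 / K is a quotient of a subspace, and local sections
    of G -> G / K are what compares the two structures. In the order e_1, e_2, e_4 the group K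
    consists of the lower triangular matrices of GL_3, so that these sections come from a
    factorization on translates of an open cell, and Gram-Schmidt makes O(3) meet every coset of
    K. *)

Section CkCalculus.
Context {R : realType} {E : normedModType R}.
Implicit Types (U : set E).

Lemma Ck_sum (I : Type) (r : seq I) k U (f : I -> E -> R) : open U ->
  (forall i, Ck k U (f i)) -> Ck k U (fun x => \sum_(i <- r) f i x).
Proof.
move=> oU cf; elim: r => [|i r IH].
  by apply: Ck_ext (Ck_cst k U 0) => // x _; rewrite big_nil.
by apply: Ck_ext (CkD oU (cf i) IH) => // x _; rewrite big_cons.
Qed.

Lemma CkN k U (f : E -> R) : open U -> Ck k U f -> Ck k U (fun x => - f x).
Proof.
move=> oU cf; apply: Ck_ext (CkM oU (Ck_cst k U (- 1)) cf) => // x _ /=.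
by rewrite mulN1r.
Qed.

(** Induction on [k]: the derivative of 1/f along v is -(1/f)(1/f) D_v f, a product of functions
    already known to be C^k. *)
Lemma CkV k U (f : E -> R) : open U -> (forall x, U x -> f x != 0) ->
  Ck k U f -> Ck k U (fun x => (f x)^-1).
Proof.
move=> oU f0; elim: k => [|k IH] cf.
  by move=> x Ux; apply: continuousV; [exact: f0|exact: cf].
have cg := IH (CkW cf); have [df dvf] := cf.
split=> [x Ux|v]; first by apply: differentiableV; [exact: df|exact: f0].
apply: Ck_ext (CkN oU (CkM oU (CkM oU cg cg) (dvf v))) => // x Ux /=.
have dx : derivable f x v by apply: diff_derivable; exact: df.
by rewrite deriveV ?f0 // -[_ *: _]/(_ * _) expr2 invfM mulNr.
Qed.

(** The derivative along [v] is the constant [f v], so a case split on [k] replaces an induction. *)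
Lemma Ck_linear k U (f : E -> R^o) : linear f -> continuous f ->
  Ck k U (f : E -> R).
Proof.
move=> lf cf; pose lfM := GRing.isLinear.Build _ _ _ _ _ lf.
pose L : {linear E -> R^o} := HB.pack f lfM.
have dL x : differentiable f x by exact: (@linear_differentiable _ _ _ L).
case: k => [|k]; first by move=> x _; exact: cf.
split=> [x _|v]; first exact: dL.
rewrite (_ : (fun x => _) = cst (f v)); first exact: Ck_cst.
by apply/funext => x; rewrite deriveE // (@diff_lin _ _ _ L).
Qed.

End CkCalculus.

Lemma continuous_sum_at (R : realType) (X : topologicalType)
    (E : normedModType R) (I : Type) (r : seq I) (f : I -> X -> E) x :
  (forall i, {for x, continuous (f i)}) ->
  {for x, continuous (fun y => \sum_(i <- r) f i y)}.
Proof.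
move=> cf; elim: r => [|i r IH].
  have -> : (fun y => \sum_(j <- [::]) f j y) = cst 0.
    by apply/funext => y; rewrite big_nil.
  exact: cst_continuous.
have -> : (fun y => \sum_(j <- i :: r) f j y) =
          (fun y => f i y + \sum_(j <- r) f j y).
  by apply/funext => y; rewrite big_cons.
by apply: continuousD => //; exact: cf.
Qed.

Lemma diff_sum_at (R : realType) (E F : normedModType R) (I : Type) (r : seq I)
    (f : I -> E -> F) x : (forall i, differentiable (f i) x) ->
  differentiable (fun y => \sum_(i <- r) f i y) x /\
  forall v, 'd (fun y => \sum_(i <- r) f i y) x v =
            \sum_(i <- r) 'd (f i) x v.
Proof.
move=> df; elim: r => [|i r [IH1 IH2]].
  have -> : (fun y => \sum_(j <- [::]) f j y) = cst 0.
    by apply/funext => y; rewrite big_nil.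
  split; first exact: differentiable_cst.
  by move=> v; rewrite big_nil diff_cst.
have -> : (fun y => \sum_(j <- i :: r) f j y) =
          (f i + fun y => \sum_(j <- r) f j y).
  by apply/funext => y; rewrite big_cons.
split; first exact: differentiableD.
by move=> v; rewrite diffD //= big_cons -IH2.
Qed.

(** A finite basis with its dual coordinates. It expresses finite dimension in the form the chain
    rule uses: [Ck] speaks of directional derivatives, so the derivative of a composite is split
    along the vectors [e i]. *)
Record coord_system (R : realType) (E : normedModType R) (I : finType)
    (c : I -> E -> R) (e : I -> E) : Prop := CoordSystem {
  coord_sum : forall x, x = \sum_i c i x *: e i;
  coord_of_sum : forall (a : I -> R) i, c i (\sum_j a j *: e j) = a i;
  coord_linear : forall i, linear (c i : E -> R^o);
  coord_cont : forall i, continuous (c i)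
}.

Section Chain.
Context {R : realType} {E F : normedModType R} {I : finType}.
Context {c : I -> F -> R} {e : I -> F}.
Hypothesis cs : coord_system c e.

Lemma coord_smooth i : Coo setT (c i).
Proof.
by move=> k; apply: Ck_linear; [exact: (coord_linear cs)|exact: (coord_cont cs)].
Qed.

Lemma coord_continuous_at (X : topologicalType) (f : X -> F) x :
  (forall i, {for x, continuous (c i \o f)}) -> {for x, continuous f}.
Proof.
move=> cf; have -> : f = fun y => \sum_i (c i \o f) y *: e i.
  by apply/funext => y; exact: coord_sum cs (f y).
apply: continuous_sum_at => i; apply: continuousZr_tmp; exact: cf.
Qed.

Lemma coord_diff (f : E -> F) x : (forall i, differentiable (c i \o f) x) ->
  differentiable f x /\
  forall v, 'd f x v = \sum_i 'd (c i \o f) x v *: e i.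
Proof.
move=> df; pose g i (y : E) := (c i \o f) y *: e i.
have fE : f = fun y => \sum_i g i y.
  by apply/funext => y; exact: coord_sum cs (f y).
have dg i : differentiable (g i) x by exact: differentiableZl.
have [d1 d2] := diff_sum_at (index_enum I) dg.
rewrite {1}fE; split=> // v; rewrite [in LHS]fE d2; apply: eq_bigr => i _.
by rewrite diffZl.
Qed.

(** The derivative of g o f along v is the sum over i of D_v (c_i o f) times (D_{e_i} g) o f. The
    induction keeps [f] and varies [g], so that it applies to the second factor. *)
Lemma Ck_comp k (U : set E) (W : set F) (f : E -> F) (g : F -> R) : open U ->
  (forall i, Ck k U (c i \o f)) -> (forall x, U x -> W (f x)) ->
  Ck k W g -> Ck k U (g \o f).
Proof.
move=> oU cf fUW; elim: k g cf => [|k IH] g cf cg.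
  move=> x Ux; apply: continuous_comp; last exact: cg (fUW _ Ux).
  by apply: coord_continuous_at => i; exact: cf.
have [dg dvg] := cg.
have df x : U x -> forall i, differentiable (c i \o f) x.
  by move=> Ux i; have [+ _] := cf i; apply.
split=> [x Ux|v].
  apply: differentiable_comp; first by have [] := coord_diff (df x Ux).
  exact: dg (fUW _ Ux).
have cfk i : Ck k U (c i \o f) by exact: CkW.
have cdf i : Ck k U (fun x => 'D_v (c i \o f) x) by have [_ +] := cf i; apply.
have := Ck_sum (index_enum I) oU
  (fun i => CkM oU (cdf i) (IH _ cfk (dvg (e i)))).
apply: Ck_ext => // x Ux /=.
have [d1 d2] := coord_diff (df x Ux).
have dgx := dg _ (fUW _ Ux).
rewrite [RHS]deriveE; last exact: differentiable_comp.
rewrite diff_comp //= d2 linear_sum /=; apply: eq_bigr => i _.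
by rewrite linearZ /= !deriveE //; exact: df.
Qed.

End Chain.

Lemma near_open (X : topologicalType) (x : X) (P : set X) :
  (\forall y \near x, P y) -> exists U, [/\ open U, U x & U `<=` P].
Proof.
move=> H; have := H : nbhs x P.
by rewrite nbhsE => -[U [? ?] ?]; exists U.
Qed.

Section SmoothAt.
Context {R : realType}.
Implicit Types X Y Z : smooth_space R.

(** Working with germs avoids shrinking open sets at each operation; [smooth_onP] shows that nothing
    is lost. *)
Definition smooth_at X (x : X) (f : X -> R) : Prop :=
  exists U, [/\ open U, U x & smooth_on U f].

Lemma smooth_onP X (U : set X) f : open U ->
  smooth_on U f <-> forall x, U x -> smooth_at x f.
Proof.
move=> oU; split=> [sf x Ux|sf]; first by exists U.
by apply: smooth_on_glue.
Qed.

Lemma smooth_at_near X (x : X) f :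
  smooth_at x f -> \forall y \near x, smooth_at y f.
Proof.
move=> [U [oU Ux sf]]; apply: filterS (open_nbhs_nbhs (conj oU Ux)) => y Uy.
by exists U.
Qed.

Lemma smooth_at_ext X (x : X) f g :
  (\forall y \near x, f y = g y) -> smooth_at x f -> smooth_at x g.
Proof.
move=> /near_open[V [oV Vx VE]] [U [oU Ux sf]].
have oUV := openI oU oV.
exists (U `&` V); split=> //.
apply: (smooth_on_ext (f := f)) => //; first by move=> y [_ /VE].
by apply: smooth_on_sub sf => // y [].
Qed.

Lemma smooth_at_continuous X (x : X) f : smooth_at x f -> {for x, continuous f}.
Proof. by move=> [U [oU Ux sf]]; exact: smooth_on_continuous sf _ Ux. Qed.

Lemma smooth_at_cst X (x : X) a : smooth_at x (cst a).
Proof.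
by exists setT; split=> //; [exact: openT|apply: smooth_on_cst; exact: openT].
Qed.

Lemma smooth_at2 X (x : X) f g : smooth_at x f -> smooth_at x g ->
  exists U, [/\ open U, U x, smooth_on U f & smooth_on U g].
Proof.
move=> [U [oU Ux sf]] [V [oV Vx sg]].
have oUV := openI oU oV.
exists (U `&` V); split=> //.
  by apply: smooth_on_sub sf => // y [].
by apply: smooth_on_sub sg => // y [].
Qed.

Lemma smooth_atD X (x : X) f g : smooth_at x f -> smooth_at x g ->
  smooth_at x (fun y => f y + g y).
Proof.
move=> /smooth_at2 H /H[U [oU Ux sf sg]].
by exists U; split=> //; exact: smooth_onD.
Qed.

Lemma smooth_atM X (x : X) f g : smooth_at x f -> smooth_at x g ->
  smooth_at x (fun y => f y * g y).
Proof.
move=> /smooth_at2 H /H[U [oU Ux sf sg]].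
by exists U; split=> //; exact: smooth_onM.
Qed.

Lemma smooth_atN X (x : X) f : smooth_at x f -> smooth_at x (fun y => - f y).
Proof.
move=> sf; have -> : (fun y => - f y) = (fun y => cst (- 1) y * f y).
  by apply/funext => y; rewrite mulN1r.
by apply: smooth_atM => //; exact: smooth_at_cst.
Qed.

Lemma smooth_atB X (x : X) f g : smooth_at x f -> smooth_at x g ->
  smooth_at x (fun y => f y - g y).
Proof. by move=> sf sg; apply: smooth_atD => //; exact: smooth_atN. Qed.

Lemma smooth_at_sum X (x : X) (I : Type) (r : seq I) (P : pred I)
    (f : I -> X -> R) : (forall i, P i -> smooth_at x (f i)) ->
  smooth_at x (fun y => \sum_(i <- r | P i) f i y).
Proof.
move=> sf; elim: r => [|i r IH].
  have -> : (fun y => \sum_(j <- [::] | P j) f j y) = cst 0.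
    by apply/funext => y; rewrite big_nil.
  exact: smooth_at_cst.
have [Pi|Pi] := boolP (P i); last first.
  rewrite (_ : (fun y => _) = (fun y => \sum_(j <- r | P j) f j y)) //.
  by apply/funext => y; rewrite big_cons (negbTE Pi).
rewrite (_ : (fun y => _) = (fun y => f i y + \sum_(j <- r | P j) f j y)).
  by apply: smooth_atD => //; exact: sf.
by apply/funext => y; rewrite big_cons Pi.
Qed.

Lemma smooth_at_prod X (x : X) (I : Type) (r : seq I) (f : I -> X -> R) :
  (forall i, smooth_at x (f i)) -> smooth_at x (fun y => \prod_(i <- r) f i y).
Proof.
move=> sf; elim: r => [|i r IH].
  have -> : (fun y => \prod_(j <- [::]) f j y) = cst 1.
    by apply/funext => y; rewrite big_nil.
  exact: smooth_at_cst.
rewrite (_ : (fun y => _) = (fun y => f i y * \prod_(j <- r) f j y)).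
  by apply: smooth_atM => //; exact: sf.
by apply/funext => y; rewrite big_cons.
Qed.

Lemma smooth_at_neq0 X (x : X) f : smooth_at x f -> f x != 0 ->
  \forall y \near x, f y != 0.
Proof.
move=> /smooth_at_continuous cf fx0.
exact: (cvgr_neq0 (f x) cf fx0).
Qed.

Definition smoothm_at X Y (x : X) (phi : X -> Y) : Prop :=
  {for x, continuous phi} /\
  forall f, smooth_at (phi x) f -> smooth_at x (f \o phi).

Lemma smooth_mapP X Y (phi : X -> Y) :
  smooth_map phi <-> forall x, smoothm_at x phi.
Proof.
split=> [[cphi sphi] x|sphi].
  split=> [|f [U [oU Ux sf]]]; first exact: cphi.
  exists (phi @^-1` U); split=> //; last exact: sphi.
  by apply: open_comp => // y _; exact: cphi.
have cphi : continuous phi by move=> x; have [] := sphi x.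
split=> // U f oU sf; apply/smooth_onP.
  by apply: open_comp => // y _; exact: cphi.
by move=> x Ux; apply: (sphi x).2; move/smooth_onP: sf; apply.
Qed.

Lemma smoothm_at_comp X Y Z (x : X) (phi : X -> Y) (psi : Y -> Z) :
  smoothm_at x phi -> smoothm_at (phi x) psi -> smoothm_at x (psi \o phi).
Proof.
move=> [c1 s1] [c2 s2]; split; first exact: continuous_comp.
by move=> f /s2 /s1.
Qed.

Lemma smoothm_at_ext X Y (x : X) (phi psi : X -> Y) :
  (\forall y \near x, phi y = psi y) -> smoothm_at x phi -> smoothm_at x psi.
Proof.
move=> E [c1 s1]; split; first exact: near_eq_continuous c1.
move=> f; rewrite -(nbhs_singleton E) => /s1; apply: smooth_at_ext.
by apply: filterS E => y /= ->.
Qed.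

Section Sub.
Variables (X : smooth_space R) (A : set X).

Lemma smooth_map_val : smooth_map (set_val : sub_space A -> X).
Proof.
split=> [|U f oU sf]; first exact: initial_continuous.
by move=> x Ux; exists U, f.
Qed.

Lemma smooth_at_subP (x : sub_space A) (f : sub_space A -> R) :
  smooth_at x f <-> exists F : X -> R, smooth_at (set_val x) F /\
    \forall y \near x, f y = F (set_val y).
Proof.
split=> [[U [oU Ux sf]]|[F [sF fF]]].
  have [W [F [oW Wx sF fF]]] := sf x Ux.
  exists F; split; first by exists W.
  have nW : nbhs x (set_val @^-1` W).
    by apply: smooth_map_val.1; exact: open_nbhs_nbhs.
  apply: filterS2 (open_nbhs_nbhs (conj oU Ux)) nW => y; exact: fF.
apply: (@smooth_at_ext (sub_space A) x (F \o set_val)).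
  by apply: filterS fF => y ->.
by move/smooth_mapP: smooth_map_val => /(_ x)[_]; apply.
Qed.

Lemma smoothm_at_sub (Y : smooth_space R) (y : Y) (s : Y -> sub_space A) :
  smoothm_at y (set_val \o s : Y -> X) -> smoothm_at y s.
Proof.
move=> [c1 s1]; have cs : {for y, continuous s}.
  move=> V /=; rewrite nbhsE => -[_ [[W oW <-] Wy] WV].
  have H : nbhs y ((set_val \o s) @^-1` W) := c1 W (open_nbhs_nbhs (conj oW Wy)).
  by apply: filterS H => z /WV.
split=> // f /smooth_at_subP[F [sF fF]].
apply: smooth_at_ext (s1 _ sF).
have H : \forall z \near y, f (s z) = F (set_val (s z)) := cs _ fF.
by apply: filterS H => z /= ->.
Qed.

(** [insubd] makes a map with values in [A] near [y] total; the default [a0] occurs only away from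
    [y]. *)
Lemma smoothm_at_insub (Y : smooth_space R) (y : Y) (a0 : A) (S : Y -> X) :
  smoothm_at y S -> (\forall z \near y, A (S z)) ->
  smoothm_at y (fun z => insubd a0 (S z) : sub_space A).
Proof.
move=> sS AS; apply: smoothm_at_sub; apply: smoothm_at_ext sS.
by apply: filterS AS => z Az; rewrite /= -[RHS]/(val _) insubdK //; exact: mem_set.
Qed.

End Sub.

Section Quot.
Variables (X : smooth_space R) (T : choiceType) (q : X -> T).

(** Smoothness at the points above [t] alone would not produce an open set of the quotient; asking
    it on whole fibres near [t] makes the open set saturated. *)
Lemma smooth_at_quotP (t : quot_space q) (f : quot_space q -> R) :
  smooth_at t f <-> \forall s \near t, forall x, q x = s -> smooth_at x (f \o q).
Proof.
split=> [[U [oU Ut sf]]|].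
  apply: filterS (open_nbhs_nbhs (conj oU Ut)) => s Us x qx.
  by exists (q @^-1` U); split=> //; rewrite /= qx.
move=> /near_open[U [oU Ut UE]]; exists U; split=> //.
by apply/(smooth_onP _ (U := q @^-1` U)) => // x Ux; exact: UE Ux _ _.
Qed.

End Quot.

(* The functional structure is stable under all smooth operations, not only
   under sums and products. *)
Definition comp_closed X : Prop :=
  forall (F : normedModType R) (I : finType) (c : I -> F -> R) (e : I -> F),
  coord_system c e -> forall (f : X -> F) (g : F -> R) (x : X),
  (forall i, smooth_at x (c i \o f)) ->
  smooth_at (f x : euclid F) g -> smooth_at x (g \o f).

Lemma smooth_at_euclidP (E : normedModType R) (x : euclid E) (f : E -> R) :
  smooth_at x f <-> exists U : set E, [/\ open U, U x & Coo U f].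
Proof. by []. Qed.

Lemma comp_closed_euclid (E : normedModType R) : comp_closed (euclid E).
Proof.
move=> F I c e cs f g x sf /smooth_at_euclidP[W [oW Wx sg]].
have cf : {for x, continuous (f : E -> F)}.
  by apply: (coord_continuous_at cs) => i; exact: smooth_at_continuous (sf i).
have: \forall y \near x, (forall i, smooth_at y (c i \o f)) /\ W (f y).
  apply: filterI; last by apply: cf; exact: open_nbhs_nbhs.
  by apply: filter_forall => i; exact: smooth_at_near.
move=> /near_open[U [oU Ux UE]]; exists U; split=> // k.
apply: (Ck_comp cs oU _ _ (sg k)) => [i|y /UE[]//].
have : smooth_on (U : set (euclid E)) (c i \o f).
  by apply/smooth_onP => // y /UE[].
exact.
Qed.

(** Only real functions on [A] come with local extensions: the coordinates of [f] are extended one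
    by one and reassembled into [f'], to which the closure of [X] applies. *)
Lemma comp_closed_sub X (A : set X) : comp_closed X ->
  comp_closed (sub_space A).
Proof.
move=> cX F I c e cs f g x sf sg.
have /choice[h hP] i := (smooth_at_subP x (c i \o f)).1 (sf i).
pose f' (y : X) := \sum_i h i y *: e i.
have ff' : \forall y \near x, f y = f' (set_val y).
  have := filter_forall (nbhs_filter x) (fun i => (hP i).2).
  apply: filterS => y H; rewrite [LHS](coord_sum cs); apply: eq_bigr => i _.
  by rewrite -H.
apply/smooth_at_subP; exists (g \o f'); split.
  apply: (cX F I c e cs); last by rewrite -(nbhs_singleton ff').
  move=> i; have [+ _] := hP i; congr smooth_at; apply/funext => y /=.
  by rewrite (coord_of_sum cs (h ^~ y)).
by apply: filterS ff' => y /= ->.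
Qed.

Lemma smoothm_at_coord X (F : normedModType R) (I : finType) (c : I -> F -> R)
    (e : I -> F) : comp_closed X -> coord_system c e ->
  forall (x : X) (f : X -> euclid F),
  (forall i, smooth_at x (c i \o f)) -> smoothm_at x f.
Proof.
move=> cX cs x f sf; split; last by move=> g; exact: (cX F I c e cs).
by apply: (coord_continuous_at cs) => i; exact: smooth_at_continuous (sf i).
Qed.

Lemma comp_closed_quot X (T : choiceType) (q : X -> T) : comp_closed X ->
  comp_closed (quot_space q).
Proof.
move=> cX F I c e cs f g t sf sg.
have cf : {for t, continuous f}.
  by apply: (coord_continuous_at cs) => i; exact: smooth_at_continuous (sf i).
apply/smooth_at_quotP.
have H := filter_forall (nbhs_filter t)
  (fun i => (smooth_at_quotP t (c i \o f)).1 (sf i)).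
have := cf _ (smooth_at_near sg); apply: filterS2 H => s H sgs x qx.
apply: (cX F I c e cs (f \o q) g) => [i|]; first exact: H qx.
by rewrite /= qx.
Qed.

End SmoothAt.

(** * Smooth quotient maps *)

Section QuotientMaps.
Context {R : realType}.
Implicit Types X Y S T Z : smooth_space R.

Lemma near_all X (x : X) (P : X -> Prop) :
  (forall y, P y) -> \forall y \near x, P y.
Proof. exact: nearW. Qed.

(** A property of maps between spaces that have structures of their own, whereas [quot_space] puts a
    structure on a bare type. *)
Definition quotient_map X T (q : X -> T) : Prop :=
  [/\ forall t, exists x, q x = t,
      forall U : set T, open U <-> open (q @^-1` U) &
      forall (U : set T) f, open U -> smooth_on U f <->
        smooth_on (q @^-1` U) (f \o q)].

Lemma quotient_map_smooth X T (q : X -> T) : quotient_map q -> smooth_map q.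
Proof.
move=> [_ qo qs]; split; first by apply/continuousP => U /qo.
by move=> U f oU; rewrite qs.
Qed.

Lemma quotient_map_quot X (T : choiceType) (q : X -> T) :
  (forall t, exists x, q x = t) -> quotient_map (q : X -> quot_space q).
Proof. by []. Qed.

Lemma quotient_map_id X : quotient_map (id : X -> X).
Proof. by split=> // t; exists t. Qed.

Lemma quotient_map_comp X Y T (q : X -> Y) (p : Y -> T) :
  quotient_map q -> quotient_map p -> quotient_map (p \o q).
Proof.
move=> [q1 q2 q3] [p1 p2 p3]; split=> [t|U|U f oU].
- by have [y <-] := p1 t; have [x <-] := q1 y; exists x.
- by rewrite p2 q2.
- by rewrite p3 // q3 //; apply/p2.
Qed.

(** The sections [a] and [b] are mere choices, possibly discontinuous; but [p \o a] composed with
    [q] gives back [p], so its smoothness is read off on [X]. *)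
Lemma quotient_map_diffeo X S T (q : X -> S) (p : X -> T) :
  quotient_map q -> quotient_map p ->
  (forall x y, q x = q y <-> p x = p y) -> diffeomorphic S T.
Proof.
move=> [q1 q2 q3] [p1 p2 p3] qp.
have [a qa] := choice q1; have [b pb] := choice p1.
exists (p \o a), (q \o b).
have paq x : p (a (q x)) = p x by apply/qp; rewrite qa.
have qbp x : q (b (p x)) = q x by apply/qp; rewrite pb.
split=> [s|t||] /=.
- by rewrite qbp.
- by rewrite paq.
- have E (U : set T) : q @^-1` ((p \o a) @^-1` U) = p @^-1` U.
    by apply/funext => x; rewrite /preimage /= paq.
  have o (U : set T) : open U -> open ((p \o a) @^-1` U).
    by move=> /p2; rewrite q2 E.
  split; first exact/continuousP.
  move=> U f oU; rewrite p3 // q3; last exact: o.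
  rewrite E (_ : (f \o (p \o a)) \o q = f \o p) //.
  by apply/funext => x /=; rewrite paq.
- have E (U : set S) : p @^-1` ((q \o b) @^-1` U) = q @^-1` U.
    by apply/funext => x; rewrite /preimage /= qbp.
  have o (U : set S) : open U -> open ((q \o b) @^-1` U).
    by move=> /q2; rewrite p2 E.
  split; first exact/continuousP.
  move=> U f oU; rewrite q3 // p3; last exact: o.
  rewrite E (_ : (f \o (q \o b)) \o p = f \o q) //.
  by apply/funext => x /=; rewrite qbp.
Qed.

(* For [p = id] this says that a smooth map with local smooth sections is a
   quotient map. *)
Lemma quotient_map_lift X Z T (phi : X -> T) (p : Z -> T) :
  smooth_map phi -> quotient_map p ->
  (forall z, exists s : Z -> X, smoothm_at z s /\
    \forall y \near z, phi (s y) = p y) ->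
  quotient_map phi.
Proof.
move=> sphi [p1 p2 p3] lift; have [cphi aphi] := sphi.
split=> [t|U|U f oU].
- have [z <-] := p1 t; have [s [_ sp]] := lift z.
  by exists (s z); rewrite (nbhs_singleton sp).
- split; first by move/continuousP : cphi; apply.
  move=> oU; apply/p2; rewrite openE => z Uz.
  have [s [[cs _] sp]] := lift z.
  have Usz : (phi @^-1` U) (s z) by rewrite /= (nbhs_singleton sp).
  have H : \forall y \near z, U (phi (s y)) :=
    cs _ (open_nbhs_nbhs (conj oU Usz)).
  by apply: filterS2 H sp => y /= + <-.
- split; first exact: aphi.
  move=> sf; apply/(p3 _ _ oU)/smooth_onP; first exact/p2.
  move=> z Uz; have [s [ss sp]] := lift z.
  (* Near [z] the function [f \o p] is [(f \o phi) \o s], and [p] detects the smoothness of [f]. *)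
  apply: (@smooth_at_ext _ _ _ ((f \o phi) \o s)).
    by apply: filterS sp => y /= ->.
  apply: ss.2; move/smooth_onP : sf; apply; last first.
    by rewrite /= (nbhs_singleton sp).
  by move/continuousP : cphi; apply.
Qed.

End QuotientMaps.

(** * Matrix-valued smooth maps *)

Section MatrixCoordinates.
Context {R : realType}.

Section Mx.
Variables m n : nat.

Lemma coord_system_mx : coord_system
  (fun p (A : 'M[R]_(m, n)) => A p.1 p.2) (fun p => delta_mx p.1 p.2).
Proof.
split=> [A|a [i j]|p|p].
- by rewrite [LHS]matrix_sum_delta pair_bigA.
- rewrite summxE (bigD1 (i, j)) //= !mxE !eqxx mulr1 big1 ?addr0 //.
  move=> [k l] /= kl; rewrite !mxE; move: kl; rewrite xpair_eqE eq_sym [l == _]eq_sym.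
  by case: (i == k); case: (j == l); rewrite ?mulr0.
- by move=> a A B; rewrite !mxE.
- exact: coord_continuous.
Qed.

End Mx.

Lemma sum_pair (E F : normedModType R) (I : Type) (r : seq I) (f : I -> E * F) :
  \sum_(i <- r) f i = (\sum_(i <- r) (f i).1, \sum_(i <- r) (f i).2).
Proof.
by elim: r => [|i r IH]; rewrite ?big_nil // !big_cons IH; case: (f i).
Qed.

Lemma coord_system_prod (E F : normedModType R) (I J : finType)
    (c : I -> E -> R) (d : J -> F -> R) (e : I -> E) (f : J -> F) :
  coord_system c e -> coord_system d f ->
  coord_system
    (fun k (x : E * F) => match k with inl i => c i x.1 | inr j => d j x.2 end)
    (fun k => match k with inl i => (e i, 0) | inr j => (0, f j) end).
Proof.
move=> cs ds.
have z (G : normedModType R) (K : finType) (a : K -> R) :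
    \sum_k a k *: (0 : G) = 0 by rewrite big1 // => k _; rewrite scaler0.
have pD (x : E) (y : F) : (x, 0) + (0, y) = (x, y) :> E * F.
  by congr pair; rewrite /= ?addr0 ?add0r.
split=> [[x y]|a k|k|k].
- rewrite big_sumType /= !sum_pair /= !z.
  by rewrite pD -(coord_sum cs) -(coord_sum ds).
- rewrite big_sumType /= !sum_pair /= !z.
  by case: k => [i|j]; rewrite ?addr0 ?add0r ?(coord_of_sum cs) ?(coord_of_sum ds).
- by case: k => [i|j] u x y /=; rewrite ?(coord_linear cs) ?(coord_linear ds).
- case: k => [i|j] x.
    by apply: continuous_comp; [exact: cvg_fst|exact: coord_cont cs i _].
  by apply: continuous_comp; [exact: cvg_snd|exact: coord_cont ds j _].
Qed.

Definition smooth_mx_at (X : smooth_space R) m n (x : X) (f : X -> 'M[R]_(m, n)) :=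
  forall i j, smooth_at x (fun y => f y i j).

Section SmoothMx.
Context {X : smooth_space R}.
Hypothesis cX : comp_closed X.

Lemma smooth_mx_atP m n (x : X) (f : X -> 'M[R]_(m, n)) :
  smooth_mx_at x f <-> smoothm_at x (f : X -> euclid 'M[R]_(m, n)).
Proof.
split=> [sf|[_ sf] i j].
  by apply: (smoothm_at_coord cX (coord_system_mx m n)) => -[i j]; exact: sf.
apply: (sf (fun A => A i j)); exists setT; split=> //; first exact: openT.
exact: coord_smooth (coord_system_mx m n) (i, j).
Qed.

(** Closure under composition, applied to inversion seen as a C^oo function on the open set of
    nonzero 1 x 1 matrices, whose coordinate system is at hand. *)
Lemma smooth_atV (x : X) f : smooth_at x f -> f x != 0 ->
  smooth_at x (fun y => (f y)^-1).
Proof.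
move=> sf fx0; pose c (p : 'I_1 * 'I_1) (A : 'M[R]_1) : R := A p.1 p.2.
have sF : smooth_mx_at x (fun y => (f y)%:M : 'M[R]_1).
  by move=> i j; apply: smooth_at_ext sf; apply: nearW => y; rewrite !ord1 mxE.
have /smooth_mx_atP[_ H] := sF.
have := H (fun A : 'M[R]_1 => (A 0 0)^-1).
rewrite (_ : _ \o _ = fun y => (f y)^-1); last first.
  by apply/funext => y /=; rewrite mxE.
have oW : open [set A : 'M[R]_1 | A 0 0 != 0].
  apply: (@open_comp _ _ (fun A : 'M[R]_1 => A 0 0) [set a : R | a != 0]).
    by move=> A _; exact: coord_continuous.
  exact: open_neq.
apply; exists [set A : 'M[R]_1 | A 0 0 != 0]; split => //=; first by rewrite mxE.
move=> k; apply: CkV => //.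
exact: Ck_sub (coord_smooth (coord_system_mx 1 1) (0, 0) k).
Qed.

Lemma smooth_mx_mul m n p (x : X) (f : X -> 'M[R]_(m, n))
    (g : X -> 'M[R]_(n, p)) : smooth_mx_at x f -> smooth_mx_at x g ->
  smooth_mx_at x (fun y => f y *m g y).
Proof.
move=> sf sg i j.
rewrite (_ : (fun y => _) = fun y => \sum_k f y i k * g y k j).
  by apply: smooth_at_sum => k _; apply: smooth_atM; [exact: sf|exact: sg].
by apply/funext => y; rewrite mxE.
Qed.

Lemma smooth_mx_tr m n (x : X) (f : X -> 'M[R]_(m, n)) :
  smooth_mx_at x f -> smooth_mx_at x (fun y => (f y)^T).
Proof.
move=> sf i j; rewrite (_ : (fun y => _) = fun y => f y j i); first exact: sf.
by apply/funext => y; rewrite mxE.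
Qed.

Lemma smooth_mx_det n (x : X) (f : X -> 'M[R]_n) :
  smooth_mx_at x f -> smooth_at x (fun y => \det (f y)).
Proof.
move=> sf; apply: smooth_at_sum => s _; apply: smooth_atM.
  exact: smooth_at_cst.
by apply: smooth_at_prod => i; exact: sf.
Qed.

(** By the cofactor formula. [invmx] is defined by cases, so the formula is used only near [x],
    where the determinant stays nonzero. *)
Lemma smooth_mx_inv n (x : X) (f : X -> 'M[R]_n) :
  smooth_mx_at x f -> f x \in unitmx -> smooth_mx_at x (fun y => invmx (f y)).
Proof.
move=> sf; rewrite unitmxE unitfE => fx0 i j.
have sd := smooth_mx_det sf.
apply: (@smooth_at_ext _ _ _ (fun y => (\det (f y))^-1 *
    ((-1) ^+ (j + i) * \det (row' j (col' i (f y)))))).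
  apply: filterS (smooth_at_neq0 sd fx0) => y fy0.
  by rewrite /invmx unitmxE unitfE fy0 !mxE.
apply: smooth_atM; first exact: smooth_atV.
apply: smooth_atM; first exact: smooth_at_cst.
apply: smooth_mx_det => k l.
rewrite (_ : (fun y => _) = fun y => f y (lift j k) (lift i l)); first exact: sf.
by apply/funext => y; rewrite !mxE.
Qed.

Lemma smooth_mx_cst m n (x : X) (A : 'M[R]_(m, n)) : smooth_mx_at x (cst A).
Proof. by move=> i j; exact: smooth_at_cst. Qed.

Lemma smooth_mx_unit_near n (x : X) (f : X -> 'M[R]_n) :
  smooth_mx_at x f -> f x \in unitmx -> \forall y \near x, f y \in unitmx.
Proof.
move=> sf; rewrite unitmxE unitfE => fx0.
apply: filterS (smooth_at_neq0 (smooth_mx_det sf) fx0) => y.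
by rewrite unitmxE unitfE.
Qed.

End SmoothMx.

Lemma smooth_mx_sub m n (A : set 'M[R]_(m, n))
    (x : sub_space (A : set (euclid 'M[R]_(m, n)))) :
  smooth_mx_at x
    (fun y : sub_space (A : set (euclid 'M[R]_(m, n))) => set_val y).
Proof.
apply/smooth_mx_atP; first exact/comp_closed_sub/comp_closed_euclid.
exact: (smooth_mapP _).1 (smooth_map_val _) _.
Qed.

Lemma smooth_map_into_mx (X : smooth_space R) m n (A : set 'M[R]_(m, n))
    (f : X -> sub_space (A : set (euclid 'M[R]_(m, n)))) : comp_closed X ->
  (forall x, smooth_mx_at x (fun y => set_val (f y))) -> smooth_map f.
Proof.
move=> cX sf; apply/smooth_mapP => x; apply: smoothm_at_sub.
exact/(smooth_mx_atP cX).
Qed.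

Lemma smooth_lift_mx (X : smooth_space R) m n (A : set 'M[R]_(m, n)) a
    (S : X -> 'M[R]_(m, n)) (x : X) : comp_closed X -> A a ->
  smooth_mx_at x S -> (\forall y \near x, A (S y)) ->
  exists s : X -> sub_space (A : set (euclid 'M[R]_(m, n))),
    smoothm_at x s /\ \forall y \near x, set_val (s y) = S y.
Proof.
move=> cX Aa sS AS; exists (fun y => insubd (SigSub (mem_set Aa) : A) (S y)).
split; first by apply: smoothm_at_insub => //; exact/(smooth_mx_atP cX).
by apply: filterS AS => y Ay; apply: insubdK; exact: mem_set.
Qed.

End MatrixCoordinates.

(** * Homogeneous spaces and fibres *)

Section Cosets.
Context {R : realType} {n : nat}.
Implicit Types G K L : set 'M[R]_n.

Lemma invmxM (A B : 'M[R]_n) : A \in unitmx -> B \in unitmx ->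
  invmx (A *m B) = invmx B *m invmx A.
Proof.
move=> uA uB; have uAB : A *m B \in unitmx by rewrite unitmx_mul uA.
apply: (can_inj (mulKmx uAB)); rewrite mulmxV // -mulmxA (mulmxA B) mulmxV //.
by rewrite mul1mx mulmxV.
Qed.

Lemma to_coset_eq G K (g h : G) : is_mx_group K -> G `<=` [set A | A \in unitmx] ->
  to_coset K g = to_coset K h <-> K (invmx (set_val g) *m set_val h).
Proof.
move=> [K1 KM KV] GU; have gU : set_val g \in unitmx by exact: GU (set_valP g).
split=> [/(congr1 val) /= E|Kk].
  have [k Kk <-] : lcoset_mx (set_val g) K (set_val h).
    by rewrite E; exists 1%:M => //; rewrite mulmx1.
  by rewrite mulmxA mulVmx // mul1mx.
have [kU KkV] := KV _ Kk.
have hE : set_val h = set_val g *m (invmx (set_val g) *m set_val h).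
  by rewrite mulmxA mulmxV // mul1mx.
apply/val_inj => /=; set k := invmx _ *m _ in Kk kU KkV hE.
rewrite hE; apply/seteqP; split=> _ [l Kl <-].
  exists (invmx k *m l); first exact: KM.
  by rewrite mulmxA -[_ *m k *m _]mulmxA mulmxV // mulmx1.
by exists (k *m l); [exact: KM|rewrite mulmxA].
Qed.

Lemma quotient_map_coset G K :
  quotient_map (to_coset K : sub_space (G : set (euclid _)) -> hom_space G K).
Proof.
have H := @quotient_map_quot R (sub_space (G : set (euclid 'M[R]_n))) _
  (@to_coset R n G K).
apply: H => t; have H2 := @cosetsP _ _ G K; have [g <-] := H2 t.
by exists g.
Qed.

Lemma comp_closed_hom G K : comp_closed (hom_space G K).
Proof. exact/comp_closed_quot/comp_closed_sub/comp_closed_euclid. Qed.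

Lemma is_mx_groupI K L : is_mx_group K -> is_mx_group L -> is_mx_group (K `&` L).
Proof.
move=> [K1 KM KV] [L1 LM LV]; split=> [//|g h [Kg Lg] [Kh Lh]|g [Kg Lg]].
  by split; [exact: KM|exact: LM].
by have [? ?] := KV _ Kg; have [? ?] := LV _ Lg.
Qed.

Lemma is_mx_group_unit K : is_mx_group K -> K `<=` [set A | A \in unitmx].
Proof. by move=> [_ _ KV] g /KV[]. Qed.

(** With x = g0 L, the map l |-> g0 l K from L to the fibre identifies the same elements as L -> L /
    K. It is a quotient map because a local section s of G -> G / K lifts it: for y in the fibre,
    g0^-1 s(y) lies in L. *)
Lemma fiber_diffeo G K L (x : hom_space G L) :
  is_mx_group G -> is_mx_group K -> is_mx_group L -> K `<=` L -> L `<=` G ->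
  (forall t : hom_space G K,
     exists s : hom_space G K -> sub_space (G : set (euclid _)),
     smoothm_at t s /\ \forall u \near t, to_coset K (s u) = u) ->
  diffeomorphic (fiber (hom_proj L : hom_space G K -> hom_space G L) x)
    (hom_space L K).
Proof.
move=> gG gK gL KL LG sec.
have [g0 g0x] := cosetsP x.
have [G1 GM GV] := gG; have [L1 LM LV] := gL.
have GU := is_mx_group_unit gG; have LU := is_mx_group_unit gL.
have g0U : set_val g0 \in unitmx by exact: GU (set_valP g0).
have aG (l : L) : G (set_val g0 *m set_val l).
  by apply: GM; [exact: set_valP|apply: LG; exact: set_valP].
pose a (l : L) : G := SigSub (mem_set (aG l)).
pose pr : hom_space G K -> hom_space G L := hom_proj L.
have prE (g : G) : pr (to_coset K g) = to_coset L g by exact: hom_projE.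
have psiF (l : L) : (pr @^-1` [set x]) (to_coset K (a l)).
  rewrite /= prE -g0x; apply/esym/to_coset_eq => //=.
  by rewrite mulmxA mulVmx // mul1mx; exact: set_valP.
pose psi (l : sub_space (L : set (euclid _))) : fiber pr x :=
  SigSub (mem_set (psiF l)).
have cF : comp_closed (fiber pr x) by apply: comp_closed_sub; exact: comp_closed_hom.
have cL : comp_closed (sub_space (L : set (euclid 'M[R]_n))).
  exact/comp_closed_sub/comp_closed_euclid.
have sa l : smoothm_at l (a : sub_space (L : set (euclid _)) ->
                              sub_space (G : set (euclid _))).
  apply: smoothm_at_sub; apply/(smooth_mx_atP cL).
  apply: smooth_mx_mul => //; [exact: smooth_mx_cst|exact: smooth_mx_sub].
have spsi : smooth_map psi.
  apply/smooth_mapP => l; apply: smoothm_at_sub.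
  have sq := quotient_map_smooth (quotient_map_coset G K).
  exact: (smoothm_at_comp (sa l) ((smooth_mapP _).1 sq (a l))).
apply: (@quotient_map_diffeo _ (sub_space (L : set (euclid 'M[R]_n)))
  (fiber pr x) (hom_space L K) psi (to_coset K)).
- apply: (quotient_map_lift spsi (quotient_map_id _)) => z.
  have [s [ss sq]] := sec (set_val z).
  pose S (y : fiber pr x) := invmx (set_val g0) *m set_val (s (set_val y)).
  pose l1 : L := SigSub (mem_set L1).
  have sval y : smoothm_at y (set_val : fiber pr x -> hom_space G K).
    exact: (smooth_mapP _).1 (smooth_map_val _) _.
  have E : \forall y \near z, to_coset K (s (set_val y)) = set_val y.
    exact: (sval z).1 sq.
  have SL : \forall y \near z, L (S y).
    apply: filterS E => y Ey; rewrite /S.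
    apply/(to_coset_eq (G := G)) => //; rewrite g0x -prE Ey.
    by rewrite (set_valP y : pr (set_val y) = x).
  exists (fun y => insubd l1 (S y)); split.
    apply: (@smoothm_at_insub _ (euclid 'M[R]_n) L (fiber pr x) z l1 S _ SL).
    apply/(smooth_mx_atP cF); apply: (smooth_mx_mul (smooth_mx_cst _ _)).
    apply/(smooth_mx_atP cF).
    have ss' := smoothm_at_comp (sval z) ss.
    have sG := (smooth_mapP _).1 (@smooth_map_val _ (euclid 'M[R]_n) G).
    exact: (smoothm_at_comp ss' (sG (s (set_val z)))).
  apply: filterS2 SL E => y Ly Ey; apply/val_inj => /=.
  rewrite -[RHS]Ey; congr to_coset; apply/val_inj => /=.
  rewrite [X in _ *m X](_ : _ = S y); last by apply: insubdK; exact: mem_set.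
  by rewrite /S mulmxA mulmxV // mul1mx.
- exact: quotient_map_coset.
- move=> l m; rewrite to_coset_eq //.
  have -> : invmx (set_val l) *m set_val m =
            invmx (set_val (a l)) *m set_val (a m).
    rewrite /= invmxM //; last exact: LU (set_valP l).
    by rewrite -mulmxA (mulmxA (invmx (set_val g0))) mulVmx // mul1mx.
  rewrite -(to_coset_eq (G := G)) //; split=> [/(congr1 val)//|E].
  exact/val_inj.
Qed.

End Cosets.

(** * Linear groups and projective spaces *)

Section Lines.
Context {F : fieldType}.

Lemma vline_eqP (V : vectType F) (u v : V) :
  <[u]>%VS = <[v]>%VS <-> exists2 c, c != 0 & u = c *: v.
Proof.
split=> [E|[c c0 ->]]; last first.
  apply/eqP; rewrite eqEsubv -!memvE memvZ ?memv_line //=.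
  by rewrite -[X in X \in _](scalerK c0) memvZ ?memv_line.
have /vlineP[c uE] : u \in <[v]>%VS by rewrite -E memv_line.
have [c0|] := eqVneq c 0; last by exists c.
exists 1; rewrite ?oner_neq0 // scale1r.
have : v \in <[u]>%VS by rewrite E memv_line.
by rewrite uE c0 scale0r => /vlineP[d ->]; rewrite scaler0.
Qed.

(** The inverse of [A] carries column [i] of [A] to e_i, so the lines agree iff [invmx A *m B]
    preserves the line of e_i. This turns equality of lines into equality of cosets. *)
Lemma vline_colP n (A B : 'M[F]_n) i : A \in unitmx -> B \in unitmx ->
  <[col i A]>%VS = <[col i B]>%VS <->
  forall k, k != i -> (invmx A *m B) k i = 0.
Proof.
move=> uA uB; set M := invmx A *m B.
have BE : B = A *m M by rewrite mulmxA mulmxV // mul1mx.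
have uM : M \in unitmx by rewrite unitmx_mul unitmx_inv uA.
have colM : col i M = invmx A *m col i B by rewrite !colE /M mulmxA.
have colB : col i B = A *m col i M by rewrite !colE mulmxA -BE.
clearbody M.
split=> [/vline_eqP[c c0 E] k ki|M0].
  have : invmx A *m col i A = c *: col i M.
    by rewrite E colM scalemxAr.
  rewrite [col i A]colE mulmxA mulVmx // mul1mx => /matrixP/(_ k 0).
  rewrite !mxE (negbTE ki) /= => /esym/eqP; rewrite mulf_eq0 (negbTE c0) /=.
  by move/eqP.
have E : col i M = M i i *: delta_mx i 0.
  apply/matrixP => k j; rewrite !mxE ord1 andbT.
  by have [->|/M0 Mki] := eqVneq k i; rewrite ?mulr1 // mulr0.
have Mii : M i i != 0.
  apply/eqP => Mii; have : invmx M *m col i M = 0.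
    by rewrite E Mii scale0r mulmx0.
  rewrite colE mulmxA mulVmx // mul1mx => /matrixP/(_ i 0).
  by rewrite !mxE !eqxx; apply/eqP; rewrite oner_neq0.
apply/vline_eqP; exists (M i i)^-1; first by rewrite invr_eq0.
by rewrite colB E -scalemxAr -colE scalerA mulVf ?scale1r.
Qed.

(** Full rank gives B = [col_ebase B] (1 | 0) [row_ebase B]; enlarging the left factor by an
    identity block makes the product square and invertible. *)
Lemma row_free_extend m k (B : 'M[F]_(m, m + k)) : row_free B ->
  exists2 A : 'M[F]_(m + k), A \in unitmx & usubmx A = B.
Proof.
move=> rB; exists (block_mx (col_ebase B) 0 0 1%:M *m row_ebase B).
  rewrite unitmx_mul row_ebase_unit andbT unitmxE det_ublock det1 mulr1 -unitmxE.
  exact: col_ebase_unit.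
rewrite -[in RHS](mulmx_ebase B) (eqP rB) -[row_ebase B in LHS]vsubmxK.
rewrite mul_block_col col_mxKu mul0mx addr0 -mulmxA; congr (_ *m _).
rewrite -[row_ebase B in RHS]vsubmxK pid_mx_row mul_row_col mul1mx mul0mx.
by rewrite addr0.
Qed.

End Lines.

Lemma unit_col (F : fieldType) n (v : 'cV[F]_n.+1) i : v != 0 ->
  exists2 A : 'M[F]_n.+1, A \in unitmx & col i A = v.
Proof.
move=> v0; have rv : row_free (v^T : 'rV[F]_(1 + n)).
  by rewrite /row_free eqn_leq rank_leq_row lt0n mxrank_eq0 trmx_eq0.
have [A uA Av] := row_free_extend rv.
(* The transpose has [v] as column 0; the exchange of columns brings it to position [i]. *)
exists (xcol i 0 A^T).
  by rewrite xcolE unitmx_mul unitmx_tr uA unitmx_perm.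
apply/matrixP => k j; rewrite !mxE ord1 tpermL.
have /matrixP/(_ 0 k) := Av; rewrite !mxE => <-; congr (A _ _); exact: val_inj.
Qed.

Lemma unit_col_neq0 (F : fieldType) n (A : 'M[F]_n) i : A \in unitmx ->
  col i A != 0.
Proof.
move=> uA; apply/eqP => A0.
have : invmx A *m col i A = 0 by rewrite A0 mulmx0.
rewrite colE mulmxA mulVmx // mul1mx => /matrixP/(_ i 0).
by rewrite !mxE !eqxx; apply/eqP; rewrite oner_neq0.
Qed.

Section GeneralLinear.
Context {R : realType}.

Definition GL n : set 'M[R]_n := [set A | A \in unitmx].
Arguments GL n : clear implicits.

Definition GLs n : smooth_space R := sub_space (GL n : set (euclid 'M[R]_n)).

Lemma comp_closed_GLs n : comp_closed (GLs n).
Proof. exact/comp_closed_sub/comp_closed_euclid. Qed.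

Definition nonzero n : smooth_space R :=
  sub_space ([set v | v != 0] : set (euclid 'cV[R]_n)).

Lemma comp_closed_nonzero n : comp_closed (nonzero n).
Proof. exact/comp_closed_sub/comp_closed_euclid. Qed.

Lemma GLs_unit n (A : GLs n) : set_val A \in unitmx.
Proof. exact: (set_valP A). Qed.

Lemma GL_col_neq0 n i (A : GLs n) : col i (set_val A) != 0.
Proof. exact: unit_col_neq0 (GLs_unit A). Qed.

Definition GL_col n i (A : GLs n) : nonzero n :=
  SigSub (mem_set (GL_col_neq0 i A : [set v | v != 0] _)).

Lemma quotient_map_GL_col n i : quotient_map (@GL_col n.+1 i).
Proof.
apply: (quotient_map_lift _ (quotient_map_id _)) => [|v0].
  apply: smooth_map_into_mx => [|A k j]; first exact: comp_closed_GLs.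
  rewrite (_ : (fun y => _) = fun y : GLs n.+1 => set_val y k i).
    exact: smooth_mx_sub.
  by apply/funext => y; rewrite mxE.
have [A uA Av] := unit_col i (set_valP v0 : set_val v0 != 0).
pose S (v : nonzero n.+1) :=
  \matrix_(k, j) if j == i then set_val v k 0 else A k j.
have SA : S v0 = A.
  apply/matrixP => k j; rewrite mxE; case: eqP => // ->.
  by rewrite -Av mxE.
have sS : smooth_mx_at v0 S.
  move=> k j; rewrite (_ : (fun y => _) =
    fun v : nonzero n.+1 => if j == i then set_val v k 0 else A k j).
    by case: eqP => _; [exact: smooth_mx_sub|exact: smooth_at_cst].
  by apply/funext => y; rewrite mxE.
have [|s [ss sE]] := smooth_lift_mx (A := GL n.+1) (@comp_closed_nonzero _) uA sS.
  have := smooth_mx_unit_near sS.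
  by rewrite SA; apply.
exists s; split=> //; apply: filterS sE => v sv; apply/val_inj => /=.
by rewrite sv; apply/matrixP => k j; rewrite !mxE eqxx ord1.
Qed.

Definition line_of n (v : nonzero n) : @line_set R n := SigSub (line_subproof v).

Lemma quotient_map_line n :
  quotient_map (@line_of n.+1 : nonzero n.+1 -> RP R n).
Proof.
have H := @quotient_map_quot R (nonzero n.+1) _ (@line_of n.+1).
apply: H => -[l lP]; have /eqP dl := set_mem lP.
have v0 : vpick l != 0 by rewrite vpick0 -dimv_eq0 dl.
exists (SigSub (mem_set (v0 : [set v | v != 0] _))); apply/val_inj => /=.
apply/eqP; rewrite eqEdim dl dim_vline v0 andbT.
by rewrite -memvE memv_pick.
Qed.

End GeneralLinear.

Arguments GL {R} n _.

(** * The group G as GL_3 *)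

Section Minor.
Context {F : fieldType} {n : nat}.
Implicit Types (i : 'I_n.+1) (g h : 'M[F]_n.+1) (B : 'M[F]_n).

Definition minor i g : 'M[F]_n := row' i (col' i g).

Definition pad i (c : F) B : 'M[F]_n.+1 := \matrix_(k, l)
  match unlift i k, unlift i l with
  | Some k', Some l' => B k' l'
  | None, None => c
  | _, _ => 0
  end.

Lemma minorE i g k l : minor i g k l = g (lift i k) (lift i l).
Proof. by rewrite !mxE. Qed.

Lemma pad_lift i c B k l : pad i c B (lift i k) (lift i l) = B k l.
Proof. by rewrite mxE !liftK. Qed.

Lemma pad_corner i c B : pad i c B i i = c.
Proof. by rewrite mxE !unlift_none. Qed.

Lemma pad_col i c B k : k != i -> pad i c B k i = 0.
Proof.
case: (unliftP i k) => [j ->|->]; last by rewrite eqxx.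
by rewrite !mxE liftK unlift_none.
Qed.

Lemma pad_row i c B k : k != i -> pad i c B i k = 0.
Proof.
case: (unliftP i k) => [j ->|->]; last by rewrite eqxx.
by rewrite !mxE liftK unlift_none.
Qed.

Lemma minor_pad i c B : minor i (pad i c B) = B.
Proof. by apply/matrixP => k l; rewrite minorE pad_lift. Qed.

Lemma det_minor_row i g : (forall k, k != i -> g i k = 0) ->
  \det g = g i i * \det (minor i g).
Proof.
move=> gi; rewrite (expand_det_row _ i) (bigD1 i) //= big1 ?addr0 => [|k ki].
  by rewrite /cofactor addnn -mul2n exprM sqrrN !expr1n mul1r.
by rewrite gi // mul0r.
Qed.

Lemma minor_tr i g : minor i g^T = (minor i g)^T.
Proof. by apply/matrixP => k l; rewrite !mxE. Qed.

Lemma det_minor_col i g : (forall k, k != i -> g k i = 0) ->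
  \det g = g i i * \det (minor i g).
Proof.
move=> gi; rewrite -det_tr (det_minor_row (i := i)); last first.
  by move=> k /gi; rewrite mxE.
by rewrite minor_tr det_tr mxE.
Qed.

Lemma det_pad i c B : \det (pad i c B) = c * \det B.
Proof.
by rewrite (det_minor_row (@pad_row i c B)) pad_corner minor_pad.
Qed.

(** The term of index i in an entry of g h contains g k i with k != i and vanishes, so a condition
    on the left factor suffices. *)
Lemma minorM_col i g h : (forall k, k != i -> g k i = 0) ->
  minor i (g *m h) = minor i g *m minor i h.
Proof.
move=> gi; apply/matrixP => k l; rewrite minorE !mxE (bigD1_ord i) //=.
rewrite gi ?mul0r ?add0r; last by rewrite eq_sym neq_lift.
by apply: eq_bigr => j _; rewrite !minorE.
Qed.

Lemma minorM_row i g h : (forall k, k != i -> h i k = 0) ->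
  minor i (g *m h) = minor i g *m minor i h.
Proof.
move=> hi; apply/trmx_inj; rewrite trmx_mul -!minor_tr trmx_mul minorM_col //.
by move=> k /hi; rewrite mxE.
Qed.

Lemma minor1 i : minor i 1%:M = 1%:M.
Proof.
by apply/matrixP => k l; rewrite minorE !mxE (inj_eq (@lift_inj _ i)).
Qed.

Lemma minor_col i g j : g i (lift i j) = 0 ->
  (forall k, k != lift i j -> g k (lift i j) = 0) <->
  (forall k, k != j -> minor i g k j = 0).
Proof.
move=> gij; split=> H k kj.
  by rewrite minorE H // (inj_eq (@lift_inj _ i)).
case: (unliftP i k) kj => [l ->|-> //].
by rewrite (inj_eq (@lift_inj _ i)) => /H; rewrite minorE.
Qed.

End Minor.

Section Block.
Context {F : fieldType}.
Implicit Types (A B : 'M[F]_3) (g h : 'M[F]_4).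

(* Indices start at 0: [o2] is the index of e_3, and the indices 0, 1, 2 of
   [res g] are those of e_1, e_2, e_4. *)
Definition o2 : 'I_4 := @Ordinal 4 2 isT.

Definition res g : 'M[F]_3 := minor o2 g.

(** The corner entry is forced by determinant 1, which is why G is a copy of GL_3. *)
Definition emb A : 'M[F]_4 := pad o2 (\det A)^-1 A.

Definition blockm g := forall k, k != o2 -> g k o2 = 0 /\ g o2 k = 0.

Lemma emb_block A : blockm (emb A).
Proof. by move=> k ko2; rewrite pad_col ?pad_row. Qed.

Lemma res_emb A : res (emb A) = A.
Proof. exact: minor_pad. Qed.

Lemma det_block g : blockm g -> \det g = g o2 o2 * \det (res g).
Proof. by move=> bg; apply: det_minor_row => k /bg[]. Qed.

Lemma res_unit g : blockm g -> \det g = 1 -> res g \in unitmx.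
Proof.
move=> bg dg; rewrite unitmxE unitfE; apply: contra_eqN dg => /eqP d0.
by rewrite det_block // d0 mulr0 eq_sym oner_eq0.
Qed.

Lemma det_emb A : A \in unitmx -> \det (emb A) = 1.
Proof. by rewrite unitmxE unitfE => dA; rewrite det_pad mulVf. Qed.

Lemma resM g h : blockm g -> res (g *m h) = res g *m res h.
Proof. by move=> bg; apply: minorM_col => k /bg[]. Qed.

Lemma block_col g i : blockm g ->
  (forall k, k != lift o2 i -> g k (lift o2 i) = 0) <->
  (forall k, k != i -> res g k i = 0).
Proof. by move=> bg; apply: minor_col; rewrite (bg _ _).2 // eq_sym neq_lift. Qed.

Lemma block_tr g : blockm g -> blockm g^T.
Proof. by move=> bg k /bg[gk gk']; rewrite !mxE. Qed.

End Block.

(** * Stabilizers as matrix groups with prescribed zeros *)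

Section Stabilizers.
Context {R : realType}.
Implicit Types g h : 'M[R]_4.

Lemma SL4_unit g : SL4 g -> g \in unitmx.
Proof. by rewrite /SL4 /= unitmxE => ->; exact: unitr1. Qed.

(** Here the numbering of the e_i from 1 meets that of ordinals from 0. *)
Lemma mul_std g (i : 'I_4) : g *m std R i.+1 = col i g.
Proof.
rewrite colE; congr (_ *m _); apply/matrixP => j k.
by rewrite !mxE ord1 andbT eqSS.
Qed.

Lemma SL4_inv g : SL4 g -> SL4 (invmx g).
Proof. by rewrite /SL4 /= det_inv => ->; rewrite invr1. Qed.

Lemma is_mx_group_Hstab i : is_mx_group (@Hstab R i).
Proof.
split=> [|g h [Sg] /vline_eqP[c c0 cE] [Sh] /vline_eqP[d d0 dE]|g [Sg]].
- by split; [exact: det1|rewrite mul1mx].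
- split; first by rewrite /SL4 /= det_mulmx Sg Sh mulr1.
  apply/vline_eqP; exists (d * c); first by rewrite mulf_neq0.
  by rewrite -mulmxA dE -scalemxAr cE scalerA.
- move=> /vline_eqP[c c0 cE]; have ug := SL4_unit Sg; split=> //.
  split; first exact: SL4_inv.
  apply/esym/vline_eqP; exists c => //.
  by rewrite scalemxAr -cE mulmxA mulVmx // mul1mx.
Qed.

(** On invertible matrices g |-> tg^-1 is a homomorphism, and [Hbar i] is the preimage of
    [Hstab i]. *)
Lemma is_mx_group_Hbar i : is_mx_group (@Hbar R i).
Proof.
have [I1 IM IV] := is_mx_group_Hstab i.
have inv_tr g : SL4 g -> SL4 (invmx g)^T.
  by move=> /SL4_inv; rewrite /SL4 /= det_tr.
have HE g : Hbar i g <-> g \in unitmx /\ Hstab i (invmx g)^T.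
  split=> [[Sg gE]|[ug [Sg gE]]].
    by split; [exact: SL4_unit|split=> //; exact: inv_tr].
  split=> //; have := SL4_inv Sg; rewrite /SL4 /=.
  by rewrite -trmx_inv invmxK det_tr.
split=> [|g h /HE[ug Hg] /HE[uh Hh]|g /HE[ug Hg]].
- by apply/HE; rewrite unitmx1 invmx1 trmx1.
- apply/HE; split; first by rewrite unitmx_mul ug.
  by rewrite invmxM // trmx_mul; exact: IM.
- split=> //; apply/HE; rewrite unitmx_inv; split=> //.
  by rewrite trmx_inv; apply: (IV _ Hg).2.
Qed.

Lemma HstabP (i : 'I_4) g : Hstab i.+1 g <->
  SL4 g /\ forall k, k != i -> g k i = 0.
Proof.
rewrite /Hstab /= -{2}(mul1mx (std R i.+1)) !mul_std.
split=> -[Sg H]; split=> //; have ug := SL4_unit Sg.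
  by have /(vline_colP _ (unitmx1 _ _) ug) := esym H; rewrite invmx1 mul1mx.
apply/esym/(vline_colP _ (unitmx1 _ _) ug).
by rewrite invmx1 mul1mx.
Qed.

Lemma HbarP (i : 'I_4) g : Hbar i.+1 g <->
  SL4 g /\ forall k, k != i -> g i k = 0.
Proof.
rewrite /Hbar /= -{2}(mul1mx (std R i.+1)) !mul_std.
have E : SL4 g -> <[col i (invmx g)^T]>%VS = <[col i 1%:M]>%VS <->
    forall k, k != i -> g i k = 0.
  move=> Sg; have ug := SL4_unit Sg.
  have ugT : (invmx g)^T \in unitmx by rewrite unitmx_tr unitmx_inv.
  rewrite (vline_colP _ ugT (unitmx1 _ _)) -trmx_inv invmxK mulmx1.
  by split=> H k /H; rewrite mxE.
by split=> -[Sg H]; split=> //; exact/E.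
Qed.

Lemma G3E : @G3 R = Hstab 3 `&` Hbar 3.
Proof.
apply/seteqP; split=> g; first by move=> [Sg ? ?].
by move=> [[Sg ?] [_ ?]].
Qed.

Lemma is_mx_group_G3 : is_mx_group (@G3 R).
Proof.
rewrite G3E; apply: is_mx_groupI; [exact: is_mx_group_Hstab|].
exact: is_mx_group_Hbar.
Qed.

Lemma G3P g : G3 g <-> SL4 g /\ blockm g.
Proof.
rewrite G3E; split=> [[/(HstabP o2)[Sg Hc] /(HbarP o2)[_ Hr]]|[Sg bg]].
  by split=> // k ko2; rewrite Hc ?Hr.
by split; [apply/(HstabP o2)|apply/(HbarP o2)]; split=> // k /bg[].
Qed.

Lemma K4P g : (G3 `&` Hstab 4) g <->
  G3 g /\ forall k, k != 2 -> res g k 2 = 0.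
Proof.
(* e_4 has index 3 in 4 x 4 matrices and index 2 in [res g]. *)
have E : lift o2 2 = 3 :> 'I_4 by exact: val_inj.
split=> -[Gg H]; split=> //; have [Sg bg] := (G3P g).1 Gg.
  by apply/(block_col _ bg); rewrite E; exact: ((HstabP 3 g).1 H).2.
by apply/(HstabP 3 g); split=> //; move/(block_col _ bg) : H; rewrite E.
Qed.

Lemma K1P g : (G3 `&` Hbar 1) g <->
  G3 g /\ forall k, k != 0 -> res g 0 k = 0.
Proof.
have E : lift o2 0 = 0 :> 'I_4 by exact: val_inj.
(* The row condition is the column condition for the transpose. *)
have T : blockm g -> (forall k, k != 0 -> g 0 k = 0) <->
    (forall k, k != 0 -> res g 0 k = 0).
  move=> /block_tr bg; have := block_col 0 bg; rewrite E /res minor_tr => -[H1 H2].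
  split=> H k k0.
    by have := H1 _ k k0; rewrite mxE; apply=> l /H; rewrite mxE.
  by have := H2 _ k k0; rewrite mxE; apply=> l /H; rewrite [_^T _ _]mxE.
split=> -[Gg H]; split=> //; have [Sg bg] := (G3P g).1 Gg.
  by apply/(T bg); exact: ((HbarP 0 g).1 H).2.
by apply/(HbarP 0 g); split=> //; exact/(T bg).
Qed.

Lemma G3_emb (A : 'M[R]_3) : A \in unitmx -> G3 (emb A).
Proof. by move=> uA; apply/G3P; split; [exact: det_emb|exact: emb_block]. Qed.

Lemma G3_res_unit g : G3 g -> res g \in unitmx.
Proof. by move=> /G3P[Sg bg]; exact: res_unit. Qed.

Lemma res_quot g h : G3 g -> G3 h -> res (invmx g *m h) = invmx (res g) *m res h.
Proof.
move=> Gg Gh; have [_ _ GV] := is_mx_group_G3.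
have [ug Ggv] := GV _ Gg; have [_ bgv] := (G3P _).1 Ggv; rewrite resM //.
congr (_ *m _); apply: (can_inj (mulmxK (G3_res_unit Gg))).
by rewrite -resM // !mulVmx ?[res _]minor1 //; exact: G3_res_unit.
Qed.

End Stabilizers.

(** * The two projective planes *)

Section Projective.
Context {R : realType}.

Definition G3s : smooth_space R := sub_space (G3 : set (euclid 'M[R]_4)).

Lemma comp_closed_G3s : comp_closed G3s.
Proof. exact/comp_closed_sub/comp_closed_euclid. Qed.

Lemma smooth_mx_minor (X : smooth_space R) n (f : X -> 'M[R]_n.+1) i x :
  smooth_mx_at x f -> smooth_mx_at x (fun y => minor i (f y)).
Proof.
move=> sf k l; apply: smooth_at_ext (sf (lift i k) (lift i l)).
by apply: near_all => y; rewrite minorE.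
Qed.

Lemma smooth_mx_pad (X : smooth_space R) n i (c : X -> R) (f : X -> 'M[R]_n) x :
  smooth_at x c -> smooth_mx_at x f ->
  smooth_mx_at x (fun y => pad i (c y) (f y)).
Proof.
move=> sc sf k l.
case: (unliftP i k) => [k' ->|->]; case: (unliftP i l) => [l' ->|->].
- by apply: smooth_at_ext (sf k' l'); apply: near_all => y; rewrite pad_lift.
- apply: smooth_at_ext (smooth_at_cst x 0); apply: near_all => y.
  by rewrite pad_col // eq_sym neq_lift.
- apply: smooth_at_ext (smooth_at_cst x 0); apply: near_all => y.
  by rewrite pad_row // eq_sym neq_lift.
- by apply: smooth_at_ext sc; apply: near_all => y; rewrite pad_corner.
Qed.

Lemma smooth_mx_emb (X : smooth_space R) (f : X -> 'M[R]_3) x :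
  comp_closed X -> smooth_mx_at x f -> f x \in unitmx ->
  smooth_mx_at x (fun y => emb (f y)).
Proof.
move=> cX sf; rewrite unitmxE unitfE => fx.
exact: smooth_mx_pad (smooth_atV cX (smooth_mx_det sf) fx) sf.
Qed.

Definition gres (g : G3s) : GLs 3 :=
  SigSub (mem_set (G3_res_unit (set_valP g) : GL 3 _)).

(** [emb] is a smooth section defined on all of GL_3. *)
Lemma quotient_map_gres : quotient_map gres.
Proof.
apply: (quotient_map_lift _ (quotient_map_id _)) => [|A0].
  apply: smooth_map_into_mx => [|g]; first exact: comp_closed_G3s.
  by apply: smooth_mx_minor; exact: smooth_mx_sub.
have AS : \forall A \near (A0 : GLs 3), G3 (emb (set_val A)).
  by apply: near_all => A; apply: G3_emb; exact: GLs_unit.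
have [|||s [ss sE]] := @smooth_lift_mx R (GLs 3) _ _ G3 1%:M
  (fun A : GLs 3 => emb (set_val A)) A0 (@comp_closed_GLs R 3).
- by have [] := @is_mx_group_G3 R.
- apply: smooth_mx_emb; [exact: comp_closed_GLs|exact: smooth_mx_sub|].
  exact: GLs_unit.
- exact: AS.
exists s; split=> //; apply: filterS sE => A sA; apply/val_inj => /=.
by rewrite -[sval (s A)]/(set_val (s A)) sA res_emb.
Qed.

Definition contragredient n (A : @GLs R n) : @GLs R n.
Proof.
refine (SigSub (mem_set (_ : GL n (invmx (set_val A))^T))).
by rewrite /GL /= unitmx_tr unitmx_inv; exact: (@GLs_unit R).
Defined.

Lemma smooth_contragredient n : smooth_map (@contragredient n).
Proof.
apply: smooth_map_into_mx => [|A]; first exact: comp_closed_GLs.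
apply/smooth_mx_tr/smooth_mx_inv; last exact: GLs_unit.
  exact: comp_closed_GLs.
exact: smooth_mx_sub.
Qed.

Lemma quotient_map_contragredient n : quotient_map (@contragredient n).
Proof.
apply: (quotient_map_lift (@smooth_contragredient n) (quotient_map_id _)) => A.
exists (@contragredient n); split.
  exact: (smooth_mapP _).1 (@smooth_contragredient n) _.
by apply: near_all => B; apply/val_inj; rewrite /= -trmx_inv invmxK trmxK.
Qed.

Lemma K4_cosetP (g h : G3s) : (G3 `&` Hstab 4) (invmx (set_val g) *m set_val h) <->
  forall k, k != 2 -> (invmx (set_val (gres g)) *m set_val (gres h)) k 2 = 0.
Proof.
have [_ GM GV] := @is_mx_group_G3 R.
have [Gg Gh] : G3 (set_val g) /\ G3 (set_val h) by split; exact: set_valP.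
rewrite K4P res_quot //; split=> [[]//|H]; split=> //.
by apply: GM => //; exact: (GV _ Gg).2.
Qed.

Lemma K1_cosetP (g h : G3s) : (G3 `&` Hbar 1) (invmx (set_val g) *m set_val h) <->
  forall k, k != 0 -> (invmx (set_val (gres g)) *m set_val (gres h)) 0 k = 0.
Proof.
have [_ GM GV] := @is_mx_group_G3 R.
have [Gg Gh] : G3 (set_val g) /\ G3 (set_val h) by split; exact: set_valP.
rewrite K1P res_quot //; split=> [[]//|H]; split=> //.
by apply: GM => //; exact: (GV _ Gg).2.
Qed.

Lemma is_mx_group_K4 : is_mx_group (G3 `&` @Hstab R 4).
Proof. apply: is_mx_groupI; [exact: is_mx_group_G3|exact: is_mx_group_Hstab]. Qed.

Lemma is_mx_group_K1 : is_mx_group (G3 `&` @Hbar R 1).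
Proof. apply: is_mx_groupI; [exact: is_mx_group_G3|exact: is_mx_group_Hbar]. Qed.

Lemma KE : G3 `&` @Hflag R = (G3 `&` Hstab 4) `&` (G3 `&` Hbar 1).
Proof. by rewrite setIACA setIid. Qed.

Lemma is_mx_group_K : is_mx_group (G3 `&` @Hflag R).
Proof.
by rewrite KE; apply: is_mx_groupI; [exact: is_mx_group_K4|exact: is_mx_group_K1].
Qed.

Lemma G3_unit : G3 `<=` [set A : 'M[R]_4 | A \in unitmx].
Proof. by apply: is_mx_group_unit; exact: is_mx_group_G3. Qed.

Lemma line_of_eq n (u v : @nonzero R n) :
  line_of u = line_of v <-> <[set_val u]>%VS = <[set_val v]>%VS.
Proof. by split=> [/(congr1 val)|E]; last exact/val_inj. Qed.

(** The coset of g goes to the line of g e_4, read as column 2 of [res g]. *)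
Lemma hom_space_K4_RP : diffeomorphic (hom_space G3 (G3 `&` Hstab 4)) (RP R 2).
Proof.
have q1 := quotient_map_comp quotient_map_gres (@quotient_map_GL_col R 2 2).
have q2 := quotient_map_comp q1 (@quotient_map_line R 2).
apply: (quotient_map_diffeo (quotient_map_coset G3 (G3 `&` Hstab 4)) q2) => g h.
rewrite (to_coset_eq g h is_mx_group_K4 G3_unit) (K4_cosetP g h).
rewrite (line_of_eq (GL_col 2 (gres g)) (GL_col 2 (gres h))).
by rewrite -vline_colP //; exact: GLs_unit.
Qed.

(** The coset of g goes to the line of tg^-1 e_1, read as column 0 of the contragredient of
    [res g]. *)
Lemma hom_space_K1_RP : diffeomorphic (hom_space G3 (G3 `&` Hbar 1)) (RP R 2).
Proof.
have q0 := quotient_map_comp quotient_map_gres (@quotient_map_contragredient 3).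
have q1 := quotient_map_comp q0 (@quotient_map_GL_col R 2 0).
have q2 := quotient_map_comp q1 (@quotient_map_line R 2).
apply: (quotient_map_diffeo (quotient_map_coset G3 (G3 `&` Hbar 1)) q2) => g h.
rewrite (to_coset_eq g h is_mx_group_K1 G3_unit) (K1_cosetP g h).
pose c := @contragredient 3.
rewrite (line_of_eq (GL_col 0 (c (gres g))) (GL_col 0 (c (gres h)))).
rewrite -[set_val (GL_col 0 (c (gres g)))]/(col 0 (invmx (set_val (gres g)))^T).
rewrite -[set_val (GL_col 0 (c (gres h)))]/(col 0 (invmx (set_val (gres h)))^T).
have := GLs_unit (gres h); have := GLs_unit (gres g).
move: (set_val (gres g)) (set_val (gres h)) => A B uA uB.
(* Exchanging the two sides makes [vline_colP] produce the transpose of [invmx A *m B], whose column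
   0 is the row that has to be tested. *)
have E : <[col 0%R (invmx A)^T]>%VS = <[col 0%R (invmx B)^T]>%VS <->
         <[col 0%R (invmx B)^T]>%VS = <[col 0%R (invmx A)^T]>%VS by split=> ->.
rewrite E vline_colP ?unitmx_tr ?unitmx_inv // -trmx_inv invmxK -trmx_mul.
by split=> H k /H; rewrite [_^T _ _]mxE.
Qed.

End Projective.

(** * Local sections of G -> G / K *)

Lemma mul_mx3 (F : pzRingType) (A B : 'M[F]_3) i j :
  (A *m B) i j = A i 0 * B 0 j + A i 1 * B 1 j + A i 2 * B 2 j.
Proof.
rewrite mxE !big_ord_recr big_ord0 /= add0r.
by congr (_ * _ + _ * _ + _ * _); congr (_ _ _); apply: val_inj.
Qed.

Lemma ord3P (i : 'I_3) : [\/ i = 0, i = 1 | i = 2].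
Proof.
case: i => [[|[|[|//]]]] lt_i; [apply: Or31|apply: Or32|apply: Or33];
  exact: val_inj.
Qed.

Section Slice.
Context {F : fieldType}.
Implicit Types B M : 'M[F]_3.

(** In the order e_1, e_2, e_4 these matrices map each term of the flag <e_4> < <e_4, e_2> into
    itself. *)
Definition lower M := [/\ M 0 1 = 0, M 0 2 = 0 & M 1 2 = 0].

Lemma lower_trig M : lower M -> is_trig_mx M.
Proof.
move=> [M01 M02 M12]; apply/is_trig_mxP => i j.
by case: (ord3P i) => ->; case: (ord3P j) => ->.
Qed.

Lemma lower_unit M : M \in unitmx -> lower M ->
  [/\ M 0 0 != 0, M 1 1 != 0 & M 2 2 != 0].
Proof.
move=> uM lM; have := uM; rewrite unitmxE unitfE (det_trig (lower_trig lM)).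
by move/prodf_neq0 => H; split; exact: H.
Qed.

(** [piv] is the product of the trailing principal minors of sizes 1 and 2; an invertible [B] is
    unipotent upper times lower triangular iff it is nonzero. Then [sx], [sy], [sz] are the entries
    (0,1), (0,2), (1,2) of the unipotent factor, by Cramer's rule. *)
Definition piv1 B := B 1 1 * B 2 2 - B 1 2 * B 2 1.
Definition piv B := B 2 2 * piv1 B.
Definition sx B := (B 0 1 * B 2 2 - B 0 2 * B 2 1) / piv1 B.
Definition sy B := B 0 2 / B 2 2.
Definition sz B := B 1 2 / B 2 2.

(* The inverse of the unipotent factor [U] of [B = U M] with [M] lower
   triangular. *)
Definition slice B : 'M[F]_3 := \matrix_(i, j)
  if i == j then 1 else if (i == 0) && (j == 1) then - sx B else
  if (i == 0) && (j == 2) then sx B * sz B - sy B else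
  if (i == 1) && (j == 2) then - sz B else 0.

Lemma slice_unit B : slice B \in unitmx.
Proof.
rewrite -unitmx_tr unitmxE (_ : \det _ = 1) ?unitr1 // det_trig.
  by rewrite big1 // => i _; rewrite !mxE eqxx.
apply/is_trig_mxP => i j.
by case: (ord3P i) => ->; case: (ord3P j) => -> // _; rewrite !mxE.
Qed.

Lemma slice_lower B : piv B != 0 -> lower (slice B *m B).
Proof.
rewrite /piv mulf_eq0 negb_or => /andP[B22 pB].
split; rewrite mul_mx3 !mxE /=; last 2 first.
- by rewrite /sy /sz; field.
- by rewrite /sz; field.
rewrite /sx /sy /sz; move: pB; rewrite /piv1 => pB; field.
by rewrite B22 pB.
Qed.

(** Each trailing minor is scaled, so the cell where [piv] is nonzero is stable under right
    multiplication by invertible lower triangular matrices. *)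
Lemma piv_lower B M : lower M -> piv (B *m M) = M 1 1 * M 2 2 ^+ 2 * piv B.
Proof. by move=> [M01 M02 M12]; rewrite /piv /piv1 !mul_mx3 M01 M02 M12; ring. Qed.

(** The lower triangular factor absorbs [M]: each of [sx], [sy], [sz] is a ratio of two minors that
    [M] scales alike. Thus [slice] descends to cosets. *)
Lemma slice_lowerM B M : M \in unitmx -> lower M -> slice (B *m M) = slice B.
Proof.
move=> uM lM; have [M0 M1 M2] := lower_unit uM lM; have [M01 M02 M12] := lM.
have E2 i : (B *m M) i 2 = M 2 2 * B i 2 by rewrite mul_mx3 M02 M12; ring.
have Ey : sy (B *m M) = sy B by rewrite /sy !E2 -mulf_div divff // mul1r.
have Ez : sz (B *m M) = sz B by rewrite /sz !E2 -mulf_div divff // mul1r.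
have Ex : sx (B *m M) = sx B.
  have E i : (B *m M) i 1 * (B *m M) 2 2 - (B *m M) i 2 * (B *m M) 2 1 =
             (M 1 1 * M 2 2) * (B i 1 * B 2 2 - B i 2 * B 2 1).
    by rewrite !E2 !mul_mx3 M01; ring.
  by rewrite /sx /piv1 !E -mulf_div divff ?mul1r // mulf_neq0.
by apply/matrixP => i j; rewrite !mxE Ex Ey Ez.
Qed.

End Slice.

Lemma smooth_mx_slice (R : realType) (X : smooth_space R) (x : X)
    (f : X -> 'M[R]_3) : comp_closed X ->
  smooth_mx_at x f -> piv (f x) != 0 -> smooth_mx_at x (fun y => slice (f y)).
Proof.
move=> cX sf; rewrite /piv mulf_eq0 negb_or => /andP[f22 pf].
have s1 : smooth_at x (fun y => piv1 (f y)).
  by apply: smooth_atB; apply: smooth_atM; exact: sf.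
have sX : smooth_at x (fun y => sx (f y)).
  apply: smooth_atM; last exact: smooth_atV.
  by apply: smooth_atB; apply: smooth_atM; exact: sf.
have s22 := smooth_atV cX (sf 2 2) f22.
have sY : smooth_at x (fun y => sy (f y)) by apply: smooth_atM => //; exact: sf.
have sZ : smooth_at x (fun y => sz (f y)) by apply: smooth_atM => //; exact: sf.
move=> i j; pose u (a b c d e : R) :=
  if i == j then a else if (i == 0) && (j == 1) then b else
  if (i == 0) && (j == 2) then c else if (i == 1) && (j == 2) then d else e.
apply: (@smooth_at_ext _ _ _ (fun y => u 1 (- sx (f y))
    (sx (f y) * sz (f y) - sy (f y)) (- sz (f y)) 0)).
  by apply: near_all => y; rewrite mxE.
rewrite /u; case: (i == j); first exact: (smooth_at_cst x 1).
case: (_ && _); first exact: smooth_atN.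
case: (_ && _); first by apply: smooth_atB => //; exact: smooth_atM.
case: (_ && _); first exact: smooth_atN.
exact: (smooth_at_cst x 0).
Qed.

Section Sections.
Context {R : realType}.

Lemma K_cosetP (g h : @G3s R) :
  (G3 `&` Hflag) (invmx (set_val g) *m set_val h) <->
  lower (invmx (set_val (gres g)) *m set_val (gres h)).
Proof.
rewrite KE; set M := invmx (set_val (gres g)) *m _.
split=> [[/K4_cosetP H4 /K1_cosetP H1]|[M01 M02 M12]].
  by split; [exact: H1|exact: H1|exact: H4].
split; [apply/K4_cosetP|apply/K1_cosetP] => k.
  by case: (ord3P k) => ->.
by case: (ord3P k) => ->.
Qed.

(** Translation by the inverse of [A0] brings the base point to the identity, which lies in the
    cell. On the cell the translated matrix is U M, and the coset is represented by A0 U, that is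
    [A0] times the inverse of the slice. *)
Lemma section_GK (t0 : hom_space (@G3 R) (G3 `&` Hflag)) :
  exists s : hom_space (@G3 R) (G3 `&` Hflag) -> G3s,
    smoothm_at t0 s /\ \forall t \near t0, to_coset (G3 `&` Hflag) (s t) = t.
Proof.
pose K : set 'M[R]_4 := G3 `&` Hflag.
pose q : G3s -> hom_space (@G3 R) K := to_coset K.
have [g0 g0t] := cosetsP t0.
pose A0 := set_val (gres g0); have uA0 : A0 \in unitmx by exact: GLs_unit.
pose b (g : @G3s R) := invmx A0 *m set_val (gres g).
have ub g : b g \in unitmx by rewrite unitmx_mul unitmx_inv uA0 GLs_unit.
have qE (g h : G3s) : q g = q h <->
    lower (invmx (set_val (gres g)) *m set_val (gres h)).
  rewrite -K_cosetP; apply: to_coset_eq; [exact: is_mx_group_K|exact: G3_unit].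
have bE g h : q g = q h -> exists2 M, M \in unitmx /\ lower M & b h = b g *m M.
  move/qE => lM; eexists; first (split; last exact: lM).
    by rewrite unitmx_mul unitmx_inv !GLs_unit.
  by rewrite /b mulmxA mulmxK // GLs_unit.
(* An arbitrary choice of representatives, with no continuity. It is harmless: [slice] and the
   condition [piv != 0] are invariant under right multiplication by invertible lower triangular
   matrices. *)
pose rep (t : hom_space (@G3 R) K) : G3s := projT1 (cid (cosetsP t)).
have repK t : q (rep t) = t by rewrite /rep; case: cid.
pose sl t := slice (b (rep t)).
have uS t : A0 *m invmx (sl t) \in unitmx.
  by rewrite unitmx_mul uA0 unitmx_inv slice_unit.
pose s t : G3s := SigSub (mem_set (G3_emb (uS t))).
have sb g : smooth_mx_at g b.
  apply: smooth_mx_mul; first exact: smooth_mx_cst.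
  by apply: smooth_mx_minor; exact: smooth_mx_sub.
have cH : comp_closed (hom_space (@G3 R) K) by exact: comp_closed_hom.
pose W : set (hom_space (@G3 R) K) := [set t | piv (b (rep t)) != 0].
have WE g : W (q g) <-> piv (b g) != 0.
  have [M [uM lM] Mb] := bE _ _ (repK (q g)).
  have [_ M1 M2] := lower_unit uM lM.
  by rewrite Mb piv_lower // mulf_eq0 mulf_eq0 expf_eq0 (negbTE M1) (negbTE M2).
have oW : open W.
  have [_ qo _] := quotient_map_coset (@G3 R) K.
  apply/qo; rewrite openE => g /WE pg.
  have sp : smooth_at g (fun h => piv (b h)).
    apply: smooth_atM; first exact: sb.
    by apply: smooth_atB; apply: smooth_atM; exact: sb.
  by apply: filterS (smooth_at_neq0 sp pg) => h ph; exact: (WE h).2 ph.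
have Wt0 : W t0.
  rewrite -g0t; apply/WE; rewrite /b mulVmx // /piv /piv1 !mxE /=.
  by rewrite !mulr1 mulr0 subr0 ?oner_neq0.
exists s; split.
  apply: smoothm_at_sub; apply/(smooth_mx_atP cH).
  apply: (@smooth_mx_emb R (hom_space G3 K) (fun t => A0 *m invmx (sl t))
    t0 cH _ (uS t0)).
  apply: smooth_mx_mul; first exact: smooth_mx_cst.
  apply: smooth_mx_inv => //; last exact: slice_unit.
  move=> i j; apply/smooth_at_quotP.
  apply: filterS (open_nbhs_nbhs (conj oW Wt0)) => t Wt g gt.
  have pg : piv (b g) != 0 := (WE g).1 (eq_ind_r W Wt gt).
  have := smooth_mx_slice (@comp_closed_G3s R) (sb g) pg i j.
  congr smooth_at; apply/funext => h /=; rewrite /sl.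
  have [M [uM lM] ->] := bE _ _ (repK (q h)).
  by rewrite slice_lowerM.
apply: filterS (open_nbhs_nbhs (conj oW Wt0)) => t Wt.
rewrite -[RHS]repK; apply/(qE (s t)).
rewrite (_ : set_val (gres (s t)) = A0 *m invmx (sl t)); last exact: res_emb.
(* What remains to be lower triangular is [slice B *m B] with [B] equal to [b (rep t)]. *)
rewrite invmxM ?unitmx_inv ?slice_unit // invmxK -mulmxA.
exact: slice_lower.
Qed.

Lemma fiber_K4 (x : hom_space (@G3 R) (G3 `&` Hstab 4)) :
  diffeomorphic
    (fiber (hom_proj (G3 `&` Hstab 4) :
              hom_space G3 (G3 `&` Hflag) -> hom_space G3 (G3 `&` Hstab 4)) x)
    (hom_space (G3 `&` Hstab 4) (G3 `&` Hflag)).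
Proof.
apply: fiber_diffeo; [exact: is_mx_group_G3|exact: is_mx_group_K|
  exact: is_mx_group_K4|by rewrite KE; exact: subIsetl|exact: subIsetl|].
exact: section_GK.
Qed.

Lemma fiber_K1 (x : hom_space (@G3 R) (G3 `&` Hbar 1)) :
  diffeomorphic
    (fiber (hom_proj (G3 `&` Hbar 1) :
              hom_space G3 (G3 `&` Hflag) -> hom_space G3 (G3 `&` Hbar 1)) x)
    (hom_space (G3 `&` Hbar 1) (G3 `&` Hflag)).
Proof.
apply: fiber_diffeo; [exact: is_mx_group_G3|exact: is_mx_group_K|
  exact: is_mx_group_K1|by rewrite KE; exact: subIsetr|exact: subIsetl|].
exact: section_GK.
Qed.

End Sections.

(** * The circle *)

Section Circle.
Context {R : realType}.

Lemma sumsq_neq0 (a b : R) : (a != 0) || (b != 0) -> a ^+ 2 + b ^+ 2 != 0.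
Proof.
move=> ab; rewrite paddr_eq0 ?sqr_ge0 // !sqrf_eq0.
by rewrite negb_and.
Qed.

Lemma nonzero_sumsq (v : 'cV[R]_2) : v != 0 -> v 0 0 ^+ 2 + v 1 0 ^+ 2 != 0.
Proof.
move=> v0; apply: sumsq_neq0; apply: contraNT v0.
rewrite negb_or !negbK => /andP[/eqP v0 /eqP v1].
apply/eqP/matrixP => i j; rewrite ord1 mxE.
by case: i => -[|[|//]] lt_i; [rewrite -[RHS]v0|rewrite -[RHS]v1];
  congr (v _ _); exact: val_inj.
Qed.

(* Doubling of angles: [z |-> z ^ 2 / |z| ^ 2]. *)
Definition square_dir (v : 'cV[R]_2) : 'rV[R]_2 := \row_j
  ((if j == 0 then v 0 0 ^+ 2 - v 1 0 ^+ 2 else v 0 0 * v 1 0 *+ 2) /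
   (v 0 0 ^+ 2 + v 1 0 ^+ 2)).

Lemma square_dir_circle (v : 'cV[R]_2) : v != 0 ->
  square_dir v 0 0 ^+ 2 + square_dir v 0 1 ^+ 2 = 1.
Proof.
move=> /nonzero_sumsq n0; rewrite !mxE /=; move: n0.
by move: (v 0 0) (v 1 0) => a b n0; field.
Qed.

Definition to_circle (v : @nonzero R 2) : circle R :=
  SigSub (mem_set (square_dir_circle (set_valP v : set_val v != 0)
    : [set w : 'rV[R]_2 | w 0 0 ^+ 2 + w 0 1 ^+ 2 = 1] _)).

Lemma comp_closed_circle : comp_closed (circle R).
Proof. exact/comp_closed_sub/comp_closed_euclid. Qed.

Lemma to_circle_smooth : smooth_map to_circle.
Proof.
apply: smooth_map_into_mx => [|v]; first exact: comp_closed_nonzero.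
have s0 : smooth_at v (fun w : nonzero 2 => set_val w 0 0) by exact: smooth_mx_sub.
have s1 : smooth_at v (fun w : nonzero 2 => set_val w 1 0) by exact: smooth_mx_sub.
have sn : smooth_at v (fun w : nonzero 2 =>
    (set_val w 0 0 ^+ 2 + set_val w 1 0 ^+ 2)^-1).
  apply: smooth_atV; first exact: comp_closed_nonzero.
    by apply: smooth_atD; exact: smooth_atM.
  exact: nonzero_sumsq (set_valP v).
move=> i j; apply: (@smooth_at_ext _ _ _ (fun w : nonzero 2 =>
  (if j == 0 then set_val w 0 0 ^+ 2 - set_val w 1 0 ^+ 2
   else set_val w 0 0 * set_val w 1 0 *+ 2) *
   (set_val w 0 0 ^+ 2 + set_val w 1 0 ^+ 2)^-1)).
  by apply: near_all => w; rewrite mxE.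
apply: smooth_atM => //; case: (j == 0).
  by apply: smooth_atB; exact: smooth_atM.
by apply: smooth_atD; exact: smooth_atM.
Qed.

Lemma col2_neq0 (a b : R) : (a != 0) || (b != 0) ->
  (\col_(i < 2) if i == 0 then a else b) != 0.
Proof.
by apply: contraL => /eqP/matrixP H; have := H 0 0; have := H 1 0;
  rewrite !mxE /= => -> ->; rewrite eqxx.
Qed.

Lemma quotient_map_to_circle : quotient_map to_circle.
Proof.
apply: (quotient_map_lift to_circle_smooth (quotient_map_id _)) => z.
pose x (y : circle R) := set_val y 0 0; pose y (y : circle R) := set_val y 0 1.
have xy w : x w ^+ 2 + y w ^+ 2 = 1 by exact: (set_valP w).
have sx : smooth_at z x by exact: smooth_mx_sub.
have sy : smooth_at z y by exact: smooth_mx_sub.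
have s1 := smooth_at_cst z 1.
(* A lift of w = (x, y) is a nonzero vector (a, b) with (a^2 - b^2, 2ab) = (a^2 + b^2) w. *)
have lift (a b : circle R -> R) : smooth_at z a -> smooth_at z b -> 
    (\forall w \near z, a w ^+ 2 + b w ^+ 2 != 0 /\
       a w ^+ 2 - b w ^+ 2 = x w * (a w ^+ 2 + b w ^+ 2) /\
       a w * b w *+ 2 = y w * (a w ^+ 2 + b w ^+ 2)) ->
    exists s : circle R -> nonzero 2, smoothm_at z s /\
      \forall w \near z, to_circle (s w) = w.
  move=> sa sb ab.
  pose S w := \col_(i < 2) if i == 0 then a w else b w.
  have Sneq0 w : a w ^+ 2 + b w ^+ 2 != 0 -> S w != 0.
    move=> n0; apply: col2_neq0; apply: contraNT n0.
    rewrite negb_or !negbK => /andP[/eqP -> /eqP ->].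
    by rewrite expr0n addr0.
  have S0 : S z != 0 by apply: Sneq0; have [] := nbhs_singleton ab.
  have sS : smooth_mx_at z S.
    move=> i j; apply: (@smooth_at_ext _ _ _
      (fun w => if i == 0 then a w else b w)).
      by apply: near_all => w; rewrite mxE.
    by case: (i == 0).
  have AS : \forall w \near z, [set v : 'cV[R]_2 | v != 0] (S w).
    by apply: filterS ab => w [/Sneq0].
  have [s [ss sE]] := smooth_lift_mx (A := [set v | v != 0])
    comp_closed_circle S0 sS AS.
  exists s; split=> //; apply: filterS2 sE ab => w sw [n0 [Ex Ey]].
  apply/val_inj/matrixP => i j; rewrite ord1. 
  rewrite -[\val (to_circle (s w))]/(square_dir (set_val (s w))) sw.
  rewrite !mxE /=; case: eqVneq => [->|j0].
    by rewrite Ex mulfK.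
  have -> : j = 1 by case: j j0 => -[|[|//]] lt_j // _; exact: val_inj.
  by rewrite Ey mulfK.
(* The half-angle vector (1 + x, y) works except at (-1, 0), where it vanishes. There (y, 1 - x) is
   used; it is parallel to the former since y^2 = (1 - x)(1 + x). *)
have [x1|x1] := eqVneq (1 + x z) 0.
  apply: (lift y (fun w => 1 - x w)) => //; first exact: smooth_atB.
  have x2 : 1 - x z != 0.
    rewrite (_ : x z = - 1) ?opprK ?(@pnatr_eq0 R 2) //.
    by apply/eqP; rewrite -addr_eq0 addrC x1.
  apply: filterS (smooth_at_neq0 (smooth_atB s1 sx) x2) => w w1.
  have yE : y w ^+ 2 = (1 - x w) * (1 + x w).
    by rewrite -[X in _ = X](_ : 1 - x w ^+ 2 = _); [rewrite -(xy w); ring|ring].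
  have nE : y w ^+ 2 + (1 - x w) ^+ 2 = 2 * (1 - x w) by rewrite yE; ring.
  rewrite nE mulf_neq0 ?(@pnatr_eq0 R 2) //; split=> //; split; last by ring.
  by rewrite yE; ring.
apply: (lift (fun w => 1 + x w) y) => //; first exact: smooth_atD.
apply: filterS (smooth_at_neq0 (smooth_atD s1 sx) x1) => w w1.
have yE : y w ^+ 2 = (1 - x w) * (1 + x w).
  by rewrite -[X in _ = X](_ : 1 - x w ^+ 2 = _); [rewrite -(xy w); ring|ring].
have nE : (1 + x w) ^+ 2 + y w ^+ 2 = 2 * (1 + x w) by rewrite yE; ring.
rewrite nE mulf_neq0 ?(@pnatr_eq0 R 2) //; split=> //; split; last by ring.
by rewrite yE; ring.
Qed.

Lemma to_circle_eq (u v : @nonzero R 2) :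
  to_circle u = to_circle v <-> <[set_val u]>%VS = <[set_val v]>%VS.
Proof.
have u0 : set_val u != 0 := set_valP u; have v0 : set_val v != 0 := set_valP v.
rewrite vline_eqP.
transitivity (square_dir (set_val u) = square_dir (set_val v)).
  by split=> [/(congr1 val)|E]; last exact/val_inj.
have nu := nonzero_sumsq u0; have nv := nonzero_sumsq v0.
move: (set_val u) (set_val v) u0 v0 nu nv => {}u {}v u0 v0 nu nv.
split=> [/matrixP E|[c c0 ->]]; last first.
  apply/matrixP => i j; rewrite !mxE; move: nv; set a := v 0 0; set b := v 1 0.
  move=> nv; have nc : (c * a) ^+ 2 + (c * b) ^+ 2 != 0.
    by rewrite !exprMn -mulrDr mulf_neq0 // expf_neq0.
  by case: (j == 0); field; rewrite nv nc.
have := E 0 1; have := E 0 0; rewrite !mxE /= => {E}.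
have uE : u = \col_i (if i == 0 then u 0 0 else u 1 0).
  apply/matrixP => i j; rewrite ord1 mxE; case: eqVneq => [->//|].
  by case: i => -[|[|//]] lt_i // _; congr (u _ _); exact: val_inj.
have vE : v = \col_i (if i == 0 then v 0 0 else v 1 0).
  apply/matrixP => i j; rewrite ord1 mxE; case: eqVneq => [->//|].
  by case: i => -[|[|//]] lt_i // _; congr (v _ _); exact: val_inj.
move: uE vE nu nv; move: (u 0 0) (u 1 0) (v 0 0) (v 1 0) => p q r s uE vE nu nv.
move=> /eqP; rewrite eqr_div // => /eqP E1 /eqP; rewrite eqr_div // => /eqP E2.
(* With z = p + iq and w = r + is, the hypotheses say that D = z^2 |w|^2 - w^2 |z|^2 vanishes.
   Taking the real part of D times the conjugate of w^2 gives -2 |w|^2 (ps - qr)^2, the identity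
   that [ring] checks up to sign. *)
have ps : p * s = q * r.
  apply/eqP; rewrite -subr_eq0 -sqrf_eq0 -(mulrI_eq0 _ (mulfI nv)).
  rewrite -(mulrI_eq0 _ (mulfI (_ : 2 != 0 :> R))) ?pnatr_eq0 //.
  rewrite (_ : 2 * _ = (s ^+ 2 - r ^+ 2) *
      ((p ^+ 2 - q ^+ 2) * (r ^+ 2 + s ^+ 2) -
       (r ^+ 2 - s ^+ 2) * (p ^+ 2 + q ^+ 2)) -
    2 * (r * s) * ((p * q *+ 2) * (r ^+ 2 + s ^+ 2) -
       (r * s *+ 2) * (p ^+ 2 + q ^+ 2))); last by ring.
  by rewrite E1 E2 !subrr !mulr0 subrr.
(* The vectors being parallel, the factor is the projection coefficient <u, v> / |v|^2. *)
have pE : p = (p * r + q * s) / (r ^+ 2 + s ^+ 2) * r.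
  apply: (mulIf nv); rewrite mulrAC divfK //.
  by rewrite [LHS](_ : _ = p * r * r + p * s * s); [rewrite ps|]; ring.
have qE : q = (p * r + q * s) / (r ^+ 2 + s ^+ 2) * s.
  apply: (mulIf nv); rewrite mulrAC divfK //.
  by rewrite [RHS](_ : _ = p * s * r + q * s * s); [rewrite ps|]; ring.
exists ((p * r + q * s) / (r ^+ 2 + s ^+ 2)).
  apply: contraNneq u0 => c0.
  have p0 : p = 0 by rewrite pE c0 mul0r.
  have q0 : q = 0 by rewrite qE c0 mul0r.
  by rewrite uE p0 q0; apply/eqP/matrixP => i j; rewrite !mxE; case: ifP.
by rewrite uE vE; apply/matrixP => i j; rewrite !mxE; case: ifP.
Qed.

(** Common to both fibres: deleting index [i] maps L onto GL_2, and K is cut out by the stabilizer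
    of the line of the second basis vector. So L / K is the space of lines of R^2. *)
Lemma hom_space_circle (L K : set 'M[R]_4) (i : 'I_3) :
  is_mx_group L -> is_mx_group K -> L `<=` G3 ->
  (forall g, L g -> minor i (res g) \in unitmx) ->
  (forall B, B \in unitmx -> L (emb (pad i 1 B))) ->
  (forall g h, L g -> L h -> K (invmx g *m h) <->
     (invmx (minor i (res g)) *m minor i (res h)) 0 1 = 0) ->
  diffeomorphic (hom_space L K) (circle R).
Proof.
move=> gL gK LG Lu Lpad LK.
have cL : comp_closed (sub_space (L : set (euclid 'M[R]_4))).
  exact/comp_closed_sub/comp_closed_euclid.
pose b (g : sub_space (L : set (euclid 'M[R]_4))) : @GLs R 2 :=
  SigSub (mem_set (Lu _ (set_valP g) : GL 2 _)).
have qb : quotient_map b.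
  apply: (quotient_map_lift _ (quotient_map_id _)) => [|B0].
    apply: smooth_map_into_mx => // g.
    by apply/smooth_mx_minor/smooth_mx_minor; exact: smooth_mx_sub.
  pose S (B : @GLs R 2) := emb (pad i 1 (set_val B)).
  have LS B : L (S B) by apply: Lpad; exact: GLs_unit.
  have [L1 _ _] := gL.
  have sS : smooth_mx_at B0 S.
    apply: smooth_mx_emb; first exact: comp_closed_GLs.
      apply: smooth_mx_pad; [exact: (smooth_at_cst B0 1)|exact: smooth_mx_sub].
    by rewrite unitmxE det_pad mul1r -unitmxE; exact: GLs_unit.
  have [s [ss sE]] := smooth_lift_mx (@comp_closed_GLs R 2) L1 sS (near_all B0 LS).
  exists s; split=> //; apply: filterS sE => B sB; apply/val_inj.
  rewrite -[\val (b (s B))]/(minor i (res (set_val (s B)))) sB.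
  by rewrite res_emb minor_pad.
have qc := quotient_map_comp (quotient_map_comp qb (@quotient_map_GL_col R 1 1))
  quotient_map_to_circle.
apply: (quotient_map_diffeo (quotient_map_coset L K) qc) => g h.
rewrite (to_coset_eq g h gK (is_mx_group_unit gL)).
rewrite (LK _ _ (set_valP g) (set_valP h)).
rewrite (to_circle_eq (GL_col 1 (b g)) (GL_col 1 (b h))).
rewrite -[set_val (GL_col 1 (b g))]/(col 1 (minor i (res (set_val g)))).
rewrite -[set_val (GL_col 1 (b h))]/(col 1 (minor i (res (set_val h)))).
rewrite vline_colP ?Lu //; [|exact: (set_valP g)|exact: (set_valP h)].
split=> [H k|]; last exact.
suff -> : (k != 1) = (k == 0) by move=> /eqP ->.
by case: k => -[|[|//]].
Qed.

Lemma K4_circle :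
  diffeomorphic (hom_space (@G3 R `&` Hstab 4) (G3 `&` Hflag)) (circle R).
Proof.
have u4 g : (@G3 R `&` Hstab 4) g -> minor 2 (res g) \in unitmx.
  move=> /K4P[Gg rg]; have := G3_res_unit Gg.
  by rewrite !unitmxE (det_minor_col rg) unitrM => /andP[].
apply: (@hom_space_circle _ _ 2) => //.
- exact: is_mx_group_K4.
- exact: is_mx_group_K.
- move=> B uB; apply/K4P; split=> [|k k2].
    by apply: G3_emb; rewrite unitmxE det_pad mul1r -unitmxE.
  by rewrite res_emb pad_col.
move=> g h Lg Lh; have [_ LM LV] := @is_mx_group_K4 R.
have [/K4P[Gg rg] /K4P[Gh rh]] := (Lg, Lh).
have LM' : (G3 `&` Hstab 4) (invmx g *m h) by apply: LM => //; exact: (LV _ Lg).2.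
have [ug _] := LV _ Lg.
(* This reduces the 2 x 2 quotient to the block of [M] alone. Membership in K4 already clears column
   2 of [res M] off the diagonal, so entry (0, 1) is all that lower triangularity adds. *)
have hE : h = g *m (invmx g *m h) by rewrite mulmxA mulmxV // mul1mx.
rewrite {2}hE; move: LM'; set M := invmx g *m h => LM'.
have [_ bg] := (G3P _).1 Gg.
rewrite resM // minorM_col // mulmxA mulVmx ?u4 // mul1mx minorE.
have E0 : lift (2 : 'I_3) (0 : 'I_2) = 0 by exact: val_inj.
have E1 : lift (2 : 'I_3) (1 : 'I_2) = 1 by exact: val_inj.
rewrite E0 E1 KE.
have /K4P[GM rM] := LM'.
split=> [[_ /K1P[_ H]]|H]; first exact: H.
split=> //; apply/K1P; split=> // k; case: (ord3P k) => -> // _; exact: rM.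
Qed.

Lemma K1_circle :
  diffeomorphic (hom_space (@G3 R `&` Hbar 1) (G3 `&` Hflag)) (circle R).
Proof.
have u1 g : (@G3 R `&` Hbar 1) g -> minor 0 (res g) \in unitmx.
  move=> /K1P[Gg rg]; have := G3_res_unit Gg.
  by rewrite !unitmxE (det_minor_row rg) unitrM => /andP[].
apply: (@hom_space_circle _ _ 0) => //.
- exact: is_mx_group_K1.
- exact: is_mx_group_K.
- move=> B uB; apply/K1P; split=> [|k k2].
    by apply: G3_emb; rewrite unitmxE det_pad mul1r -unitmxE.
  by rewrite res_emb pad_row.
move=> g h Lg Lh; have [_ LM LV] := @is_mx_group_K1 R.
have [/K1P[Gg rg] /K1P[Gh rh]] := (Lg, Lh).
have LM' : (G3 `&` Hbar 1) (invmx g *m h) by apply: LM => //; exact: (LV _ Lg).2.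
have [ug _] := LV _ Lg.
have hE : h = g *m (invmx g *m h) by rewrite mulmxA mulmxV // mul1mx.
rewrite {2}hE; move: LM'; set M := invmx g *m h => LM'.
have [_ bg] := (G3P _).1 Gg; have /K1P[GM rM] := LM'.
rewrite resM // minorM_row // mulmxA mulVmx ?u1 // mul1mx minorE.
(* Now row 0 of [res M] is the one already cleared, and the remaining entry is (1, 2). *)
have E0 : lift (0 : 'I_3) (0 : 'I_2) = 1 by exact: val_inj.
have E1 : lift (0 : 'I_3) (1 : 'I_2) = 2 by exact: val_inj.
rewrite E0 E1 KE.
split=> [[/K4P[_ H] _]|H]; first exact: H.
split=> //; apply/K4P; split=> // k; case: (ord3P k) => -> // _; exact: rM.
Qed.

End Circle.

(** * Flags *)

Section FlagAlgebra.
Context {F : fieldType}.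

Lemma free2P (V : vectType F) (u v : V) :
  free [:: u; v] <-> forall a b, a *: u + b *: v = 0 -> a = 0 /\ b = 0.
Proof.
split=> [/(@freeP _ _ _ (in_tuple [:: u; v])) H a b ab0|H].
  have := H (fun i => if i == 0 then a else b).
  rewrite !big_ord_recl big_ord0 /= addr0 => /(_ ab0) {}H.
  by split; [exact: (H 0)|exact: (H 1)].
apply/(@freeP _ _ _ (in_tuple [:: u; v])) => k.
rewrite !big_ord_recl big_ord0 /= addr0 => /H[k0 k1].
by case=> -[|[|//]] lt_i; [rewrite -k0|rewrite -k1]; congr k; exact: val_inj.
Qed.

Lemma mem_span2 (V : vectType F) (u v w : V) :
  w \in <<[:: u; v]>>%VS <-> exists a b, w = a *: u + b *: v.
Proof.
rewrite span_cons span_seq1; split.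
  by move=> /memv_addP[_ /vlineP[a ->] [_ /vlineP[b ->] ->]]; exists a, b.
by move=> [a [b ->]]; apply: memv_add; rewrite memvZ ?memv_line.
Qed.

Lemma dim_span2 (V : vectType F) (u v : V) : free [:: u; v] ->
  \dim <<[:: u; v]>>%VS = 2.
Proof. by move/eqP. Qed.

Lemma mul_col3 (A M : 'M[F]_3) j :
  col j (A *m M) = M 0 j *: col 0 A + M 1 j *: col 1 A + M 2 j *: col 2 A.
Proof.
apply/matrixP => i k; rewrite mxE mul_mx3 !mxE.
by congr (_ + _ + _); rewrite mulrC.
Qed.

Lemma free_cols (A : 'M[F]_3) : A \in unitmx -> free [:: col 2 A; col 1 A].
Proof.
move=> uA; apply/free2P => a b ab0.
have : invmx A *m (a *: col 2 A + b *: col 1 A) = 0 by rewrite ab0 mulmx0.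
rewrite mulmxDr -!scalemxAr !colE !mulmxA mulVmx // !mul1mx => /matrixP H.
have := H 2 0; have := H 1 0; rewrite !mxE /= !mulr1 !mulr0 addr0 add0r.
by move=> -> ->.
Qed.

(** The flag of [A] is the image under [A] of the flag of the identity matrix, so equality says that
    [invmx A *m B] preserves the latter. In the converse, one inclusion of planes suffices by
    dimension. *)
Lemma flag_colsP (A B : 'M[F]_3) : A \in unitmx -> B \in unitmx ->
  (<[col 2%R A]>%VS = <[col 2%R B]>%VS /\
   <<[:: col 2%R A; col 1%R A]>>%VS = <<[:: col 2%R B; col 1%R B]>>%VS) <->
  lower (invmx A *m B).
Proof.
move=> uA uB; rewrite vline_colP //.
have BE : B = A *m (invmx A *m B) by rewrite mulmxA mulmxV // mul1mx.
split=> [[H2 H]|[M01 M02 M12]].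
  split; [|exact: H2|exact: H2].
  have /mem_span2[a [b E]] : col 1 B \in <<[:: col 2 A; col 1 A]>>%VS.
    by rewrite H memv_span // !inE eqxx orbT.
  have : col 1 (invmx A *m B) = a *: col 2 1%:M + b *: col 1 1%:M.
    rewrite colE -mulmxA -colE E mulmxDr -!scalemxAr !colE !mulmxA.
    by rewrite mulVmx // !mul1mx.
  by move=> /matrixP/(_ 0 0); rewrite !mxE /= !mulr0 addr0.
split; first by move=> k; case: (ord3P k) => ->.
apply/esym/eqP; rewrite eqEdim !dim_span2 ?free_cols // leqnn andbT.
apply/span_subvP => w; rewrite !inE => /orP[] /eqP ->; apply/mem_span2.
  exists ((invmx A *m B) 2 2), 0.
  by rewrite {1}BE mul_col3 M02 M12 !scale0r !add0r addr0.
exists ((invmx A *m B) 2 1), ((invmx A *m B) 1 1).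
by rewrite {1}BE mul_col3 M01 scale0r add0r addrC.
Qed.

Lemma unit_col2 (u v : 'cV[F]_3) : free [:: u; v] ->
  exists2 A : 'M[F]_3, A \in unitmx & col 2 A = u /\ col 1 A = v.
Proof.
move=> /free2P uv.
pose B : 'M[F]_(2, 2 + 1) := \matrix_(i, j) if i == 0 then u j 0 else v j 0.
have rB : row_free B.
  apply: inj_row_free => w wB; have [w0 w1] : w 0 0 = 0 /\ w 0 1 = 0.
    apply: uv; apply/matrixP => i j; rewrite ord1.
    have E : (w *m B) 0 i = w 0 0 * u i 0 + w 0 1 * v i 0.
      rewrite mxE !big_ord_recl big_ord0 addr0 !mxE /=.
      by congr (_ + w _ _ * _); exact: val_inj.
    by rewrite !mxE -E wB mxE.
  apply/matrixP => i j; rewrite ord1 mxE.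
  by case: j => -[|[|//]] lt_j; [rewrite -[RHS]w0|rewrite -[RHS]w1];
    congr (w _ _); exact: val_inj.
have [A uA /matrixP AB] := row_free_extend rB.
(* Transposition turns the rows [u], [v] into columns 0 and 1; the swap moves [u] to column 2 and
   leaves [v] in place. *)
pose s : 'S_3 := tperm 0 2.
exists (col_perm s A^T).
  by rewrite col_permE unitmx_mul unitmx_tr uA unitmx_perm.
split; apply/matrixP => i j; rewrite ord1 !mxE.
  rewrite tpermR; have := AB 0 i; rewrite !mxE /= => <-.
  by congr (A _ _); exact: val_inj.
rewrite tpermD //; have := AB 1 i; rewrite !mxE /= => <-.
by congr (A _ _); exact: val_inj.
Qed.

End FlagAlgebra.

Section FlagManifold.
Context {R : realType} {V : vectType R}.
Hypothesis dimV : \dim {:V} = 3%N.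

Definition to_row (u : 'cV[R]_3) : 'rV[R]_(\dim {:V}) :=
  \row_j u (cast_ord dimV j) 0.

Definition to_col (x : 'rV[R]_(\dim {:V})) : 'cV[R]_3 :=
  \col_i x 0 (cast_ord (esym dimV) i).

Lemma to_colK : cancel to_col to_row.
Proof.
by move=> x; apply/matrixP => i j; rewrite ord1 !mxE cast_ordK.
Qed.

Lemma to_rowK : cancel to_row to_col.
Proof.
by move=> x; apply/matrixP => i j; rewrite ord1 !mxE cast_ordKV.
Qed.

(** The isomorphism R^3 -> V given by [vbasis]. The casts hidden in [to_row] are there because
    [\dim {:V}] equals 3 only through the hypothesis [dimV]. *)
Definition vec_of (u : 'cV[R]_3) : V := of_coord (to_row u).

Lemma vec_of_linear : linear vec_of.
Proof.
move=> a u v; rewrite /vec_of /of_coord scaler_sumr -big_split /=.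
by apply: eq_bigr => i _; rewrite !mxE scalerDl scalerA.
Qed.

HB.instance Definition _ :=
  GRing.isLinear.Build R 'cV[R]_3 V _ vec_of vec_of_linear.

Definition vec_hom : 'Hom('cV[R]_3, V) := linfun vec_of.

Lemma vec_homE u : vec_hom u = vec_of u.
Proof. by rewrite lfunE. Qed.

Lemma vec_hom_ker : lker vec_hom == 0%VS.
Proof.
apply/lker0P => u v; rewrite !vec_homE => /eqP.
rewrite -subr_eq0 -raddfB => /eqP uv0; apply/eqP; rewrite -subr_eq0; apply/eqP.
rewrite -[LHS]to_rowK; move: (u - v) uv0 => {u}{}v v0.
have /freeP H := basis_free (vbasisP {:V}).
apply/matrixP => i j; rewrite !mxE.
by have := H _ v0 (cast_ord (esym dimV) i); rewrite mxE.
Qed.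

Lemma of_coord_surj (w : V) : exists x, of_coord x = w.
Proof.
exists (\row_i coord (vbasis {:V}) i w); rewrite [RHS](coord_vbasis (memvf w)).
by apply: eq_bigr => i _; rewrite mxE.
Qed.

Lemma free_vec (u v : 'cV[R]_3) :
  free [:: vec_of u; vec_of v] = free [:: u; v].
Proof.
rewrite -!vec_homE /free -[[:: _; _]]/(map vec_hom [:: u; v]) size_map -limg_span.
by rewrite limg_dim_eq // (eqP vec_hom_ker) capv0.
Qed.

Lemma flag_vecP (u v u' v' : 'cV[R]_3) :
  (<[vec_of u]>%VS, <<[:: vec_of u; vec_of v]>>%VS) =
  (<[vec_of u']>%VS, <<[:: vec_of u'; vec_of v']>>%VS) <->
  <[u]>%VS = <[u']>%VS /\ <<[:: u; v]>>%VS = <<[:: u'; v']>>%VS.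
Proof.
rewrite -!vec_homE -!limg_line -[[:: vec_hom u; _]]/(map vec_hom [:: u; v]).
rewrite -[[:: vec_hom u'; _]]/(map vec_hom [:: u'; v']) -!limg_span.
split=> [[/eqP + /eqP]|[-> ->]//].
by rewrite !eq_limg_ker0 ?vec_hom_ker // => /eqP -> /eqP ->.
Qed.

Definition frame_space : smooth_space R :=
  sub_space (@frames R V : set (euclid _)).

Definition flag_of (p : frame_space) : @flag_set R V :=
  SigSub (flag_subproof p).

Lemma quotient_map_flag : quotient_map (flag_of : frame_space -> flags V).
Proof.
have H := @quotient_map_quot R frame_space _ flag_of.
apply: H => -[[l E] lP]; have [/= lE [dl dE]] := set_mem lP.
(* [b] spans a complement of the line in the plane, so that (a, b) is a frame of the flag. *)
pose a := vpick l; pose b := vpick (E :\: l)%VS.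
have a0 : a != 0 by rewrite vpick0 -dimv_eq0 dl.
have la : l = <[a]>%VS.
  by apply/esym/eqP; rewrite eqEdim dl dim_vline a0 andbT -memvE memv_pick.
have dd : \dim (E :\: l)%VS = 1%N.
  have := dimv_cap_compl E l.
  by rewrite (capv_idPr lE) dl dE => -[].
have b0 : b != 0 by rewrite vpick0 -dimv_eq0 dd.
have ElE : (E :\: l)%VS = <[b]>%VS.
  by apply/esym/eqP; rewrite eqEdim dd dim_vline b0 andbT -memvE memv_pick.
have Eab : E = <<[:: a; b]>>%VS.
  by rewrite span_cons span_seq1 -la -ElE addvC addv_diff (addv_idPl lE).
have fab : free [:: a; b] by rewrite /free -Eab dE.
have [x xa] := of_coord_surj a; have [y yb] := of_coord_surj b.
have xyP : @frames R V (x, y) by rewrite /frames /= xa yb.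
exists (SigSub (mem_set xyP)); apply/val_inj => /=.
by rewrite xa yb -la -Eab.
Qed.

Lemma GL_frame_subproof (A : @GLs R 3) :
  frames (to_row (col 2 (set_val A)), to_row (col 1 (set_val A))).
Proof.
rewrite /frames /= -![of_coord _]/(vec_of _) free_vec.
by apply: free_cols; exact: GLs_unit.
Qed.

Definition GL_frame (A : @GLs R 3) : frame_space :=
  SigSub (mem_set (GL_frame_subproof A)).

Let cs_frame := coord_system_prod (coord_system_mx (R := R) 1 (\dim {:V}))
  (coord_system_mx (R := R) 1 (\dim {:V})).

Lemma smooth_GL_frame : smooth_map GL_frame.
Proof.
apply/smooth_mapP => A; apply: smoothm_at_sub.
apply: (smoothm_at_coord (@comp_closed_GLs R 3) cs_frame) => -[[i j]|[i j]].
  apply: (@smooth_at_ext _ _ _ (fun B : @GLs R 3 => set_val B (cast_ord dimV j) 2)).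
    by apply: near_all => B /=; rewrite !mxE.
  exact: smooth_mx_sub.
apply: (@smooth_at_ext _ _ _ (fun B : @GLs R 3 => set_val B (cast_ord dimV j) 1)).
  by apply: near_all => B /=; rewrite !mxE.
exact: smooth_mx_sub.
Qed.

Lemma quotient_map_GL_frame : quotient_map GL_frame.
Proof.
apply: (quotient_map_lift smooth_GL_frame (quotient_map_id _)) => p0.
have cF : comp_closed frame_space by exact/comp_closed_sub/comp_closed_euclid.
have [A uA [A2 A1]] : exists2 A : 'M[R]_3, A \in unitmx &
    col 2 A = to_col (set_val p0).1 /\ col 1 A = to_col (set_val p0).2.
  apply: unit_col2; rewrite -free_vec /vec_of !to_colK.
  exact: (set_valP p0).
(* Column 0 of [A] completes the frame at [p0] to a basis, hence also the nearby frames. *)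
pose S (p : frame_space) : 'M[R]_3 := \matrix_(i, j)
  if j == 2 then to_col (set_val p).1 i 0 else
  if j == 1 then to_col (set_val p).2 i 0 else A i j.
have SA : S p0 = A.
  by apply/matrixP => i j; rewrite mxE; case: (ord3P j) => -> //=;
    rewrite -?A2 -?A1 mxE.
have sc k : smooth_at p0 (fun p : frame_space => match k with
    | inl ij => (set_val p).1 ij.1 ij.2 | inr ij => (set_val p).2 ij.1 ij.2 end).
  have := (smooth_mapP _).1 (@smooth_map_val _ (euclid _) (@frames R V)) p0.
  case=> _ sv; have := sv (fun p => match k with
    | inl ij => p.1 ij.1 ij.2 | inr ij => p.2 ij.1 ij.2 end).
  apply; exists setT; split=> //; first exact: openT.
  exact: (coord_smooth cs_frame k).
have sS : smooth_mx_at p0 S.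
  move=> i j; apply: (@smooth_at_ext _ _ _ (fun p : frame_space =>
    if j == 2 then (set_val p).1 0 (cast_ord (esym dimV) i) else
    if j == 1 then (set_val p).2 0 (cast_ord (esym dimV) i) else A i j)).
    by apply: near_all => p; rewrite !mxE.
  case: (j == 2); first exact: (sc (inl (0, _))).
  case: (j == 1); first exact: (sc (inr (0, _))).
  exact: (smooth_at_cst p0 (A i j)).
have AS : \forall p \near p0, GL 3 (S p).
  by have := smooth_mx_unit_near sS; rewrite SA; apply.
have [s [ss sE]] := smooth_lift_mx (A := GL 3) cF uA sS AS.
exists s; split=> //; apply: filterS sE => p sp; apply/val_inj.
rewrite -[\val (GL_frame (s p))]/(to_row (col 2 (set_val (s p))),
  to_row (col 1 (set_val (s p)))) sp.
rewrite [RHS]surjective_pairing; congr (_, _).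
  by rewrite -[RHS]to_colK; congr to_row; apply/matrixP => i j; rewrite ord1 !mxE.
by rewrite -[RHS]to_colK; congr to_row; apply/matrixP => i j; rewrite ord1 !mxE.
Qed.

Lemma hom_space_K_flags :
  diffeomorphic (hom_space (@G3 R) (G3 `&` Hflag)) (flags V).
Proof.
have q := quotient_map_comp (quotient_map_comp quotient_map_gres
  quotient_map_GL_frame) quotient_map_flag.
apply: (quotient_map_diffeo (quotient_map_coset G3 (G3 `&` Hflag)) q) => g h.
rewrite (to_coset_eq g h (@is_mx_group_K R) (@G3_unit R)) (K_cosetP g h).
rewrite -flag_colsP; [|exact: GLs_unit|exact: GLs_unit].
rewrite -flag_vecP; split=> [E|/(congr1 val)]; last exact.
exact/val_inj.
Qed.

End FlagManifold.

(** * Compactness *)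

Section GramSchmidt.
Context {R : realType}.

Lemma gram_gt0 m n (W : 'M[R]_(m, n)) j : col j W != 0 -> 0 < (W^T *m W) j j.
Proof.
move=> W0; rewrite mxE (eq_bigr (fun k => W k j ^+ 2)); last first.
  by move=> k _; rewrite mxE expr2.
rewrite lt0r sumr_ge0 => [|k _]; last exact: sqr_ge0.
rewrite andbT; apply: contra W0 => /eqP Wj0; apply/eqP/matrixP => k l.
have /eqP : W k j ^+ 2 = 0.
  by apply: (psumr_eq0P _ Wj0) => // i _; exact: sqr_ge0.
by rewrite sqrf_eq0 !mxE => /eqP.
Qed.

Definition normalize n (W : 'M[R]_n) : 'M[R]_n :=
  W *m diag_mx (\row_j (Num.sqrt ((W^T *m W) j j))^-1).

Lemma normalize_orthogonal n (W : 'M[R]_n) :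
  (forall j, col j W != 0) -> (forall i j, i != j -> (W^T *m W) i j = 0) ->
  (normalize W)^T *m normalize W = 1%:M.
Proof.
move=> W0 Wo; rewrite /normalize; set d := \row__ _.
have dE k : d 0 k = (Num.sqrt ((W^T *m W) k k))^-1 by rewrite mxE.
rewrite trmx_mul tr_diag_mx -mulmxA (mulmxA W^T).
apply/matrixP => i j; rewrite mul_diag_mx mul_mx_diag.
rewrite mxE [X in _ * X]mxE !dE [RHS]mxE.
have [<-|ij] := eqVneq i j; last by rewrite (Wo _ _ ij) mul0r mulr0.
have Wi := gram_gt0 (W0 i); rewrite mulrCA -invfM -expr2 sqr_sqrtr ?ltW //.
by rewrite divff // gt_eqF.
Qed.

(* Gram-Schmidt on the last two columns of [A], completed by the first row of
   [A^-1], which is orthogonal to them. *)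
Lemma orthogonal_lower (A : 'M[R]_3) : A \in unitmx ->
  exists Q : 'M[R]_3, Q^T *m Q = 1%:M /\ lower (Q^T *m A).
Proof.
move=> uA; pose S := A^T *m A.
have SE i j : S i j = A 0 i * A 0 j + A 1 i * A 1 j + A 2 i * A 2 j.
  by rewrite /S mul_mx3 !mxE.
have S21 : S 2 1 = S 1 2 by rewrite -[in LHS](trmxK S) mxE trmx_mul trmxK.
have S22 : S 2 2 != 0 by rewrite gt_eqF // gram_gt0 // unit_col_neq0.
(* Column 1 of [W] is [S 2 2] times the component of column 1 of [A] orthogonal to column 2; the
   factor avoids a division. *)
clearbody S; pose W : 'M[R]_3 := \matrix_(i, j) if j == 0 then invmx A 0 i else
  if j == 1 then S 2 2 * A i 1 - S 1 2 * A i 2 else A i 2.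
have W0A j : (W^T *m A) 0 j = (0 == j)%:R.
  have -> : (W^T *m A) 0 j = (invmx A *m A) 0 j.
    by rewrite !mul_mx3 ![W^T _ _]mxE ![W _ _]mxE.
  by rewrite mulVmx // mxE.
have W1A j : (W^T *m A) 1 j = S 2 2 * S 1 j - S 1 2 * S 2 j.
  rewrite [LHS]mul_mx3 (SE 1 j) (SE 2 j).
  by rewrite ![W^T _ _]mxE ![W _ _]mxE /=; ring.
have W2A j : (W^T *m A) 2 j = S 2 j.
  by rewrite [LHS]mul_mx3 (SE 2 j) ![W^T _ _]mxE ![W _ _]mxE.
have mulW1 (B : 'M[R]_3) i :
    (B *m W) i 1 = S 2 2 * (B *m A) i 1 - S 1 2 * (B *m A) i 2.
  by rewrite !mul_mx3 ![W _ _]mxE /=; ring.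
have mulW2 (B : 'M[R]_3) i : (B *m W) i 2 = (B *m A) i 2.
  by rewrite !mul_mx3 ![W _ _]mxE.
have WWs i j : (W^T *m W) i j = (W^T *m W) j i.
  by rewrite -[in LHS](trmxK (W^T *m W)) mxE trmx_mul trmxK.
have WW01 : (W^T *m W) 0 1 = 0 by rewrite mulW1 !W0A !mulr0 subrr.
have WW02 : (W^T *m W) 0 2 = 0 by rewrite mulW2 W0A.
have WW12 : (W^T *m W) 1 2 = 0 by rewrite mulW2 W1A mulrC subrr.
exists (normalize W); split.
  apply: normalize_orthogonal => [j|i j].
    (* A zero column of [W] clears a row of [W^T *m A], whose entries (0,0) and (2,2) are 1 and
       [S 2 2]. For column 1 the contradiction comes from entry (1,1) of [invmx A *m W], again
       [S 2 2]. *)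
    apply/eqP => Wj; have WT k : (W^T *m A) j k = 0.
      rewrite mxE big1 // => l _; rewrite [W^T _ _]mxE.
      by have /matrixP/(_ l 0) := Wj; rewrite mxE => ->; rewrite !mxE mul0r.
    case: (ord3P j) Wj WT => -> Wj WT.
    - by have /eqP := WT 0; rewrite W0A eqxx oner_eq0.
    - have : (invmx A *m W) 1 1 = 0.
        have : (invmx A *m col 1 W) 1 0 = 0 by rewrite Wj mulmx0 mxE.
        by rewrite colE mulmxA -colE mxE.
      rewrite mulW1 mulVmx // !mxE /= mulr1 mulr0 subr0.
      by apply/eqP.
    - by move/eqP: S22; rewrite -W2A WT.
  by case: (ord3P i) => ->; case: (ord3P j) => -> // _; rewrite // WWs.
(* Normalization only rescales the rows of [W^T *m A], which preserves the zeros above the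
   diagonal. *)
rewrite /normalize trmx_mul tr_diag_mx -mulmxA.
split; rewrite mul_diag_mx mxE; first by rewrite W0A mulr0.
  by rewrite W0A mulr0.
by rewrite W1A [S 1 2 * _]mulrC subrr mulr0.
Qed.

Lemma smooth_vec_mx n (v : euclid 'rV[R]_(n * n)) :
  smooth_mx_at v (fun w : euclid 'rV[R]_(n * n) => vec_mx w : 'M[R]_n).
Proof.
move=> k l; apply: (@smooth_at_ext _ (euclid 'rV[R]_(n * n)) _
  (fun w => w 0 (mxvec_index k l))).
  by apply: near_all => w; rewrite mxE.
exists setT; split=> //; first exact: openT.
exact: (coord_smooth (coord_system_mx 1 (n * n)) (0, mxvec_index k l)).
Qed.

(** A closed subset of a cube, since unit columns bound the entries by 1. Flattening matrices to row
    vectors lets [rV_compact] handle the cube. *)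
Lemma orthogonal_compact n :
  compact [set v : 'rV[R]_(n * n) | (vec_mx v)^T *m vec_mx v = 1%:M].
Proof.
pose B : set 'rV[R]_(n * n) := [set v | forall i, `[-1, 1]%classic (v ord0 i)].
apply: (@subclosed_compact _ _ B).
- rewrite -openC openE => v /= vn1.
  have [i [j vij]] : exists i j,
      ((vec_mx v)^T *m vec_mx v) i j != (1%:M : 'M[R]_n) i j.
    apply: contrapT => H; apply: vn1; apply/matrixP => i j.
    by apply/eqP; apply: contrapT => /negP vij; apply: H; exists i, j.
  have sv := smooth_vec_mx (v : euclid 'rV[R]_(n * n)).
  have := smooth_at_neq0 (smooth_atB (smooth_mx_mul (smooth_mx_tr sv) sv i j)
    (smooth_at_cst (v : euclid 'rV[R]_(n * n)) ((1%:M : 'M[R]_n) i j))).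
  rewrite subr_eq0 => /(_ vij); apply: filterS => w + w1.
  by rewrite subr_eq0 w1 eqxx.
- have H := @rV_compact R (n * n) (fun=> `[-1, 1]%classic : set R).
  by apply: H => i; exact: segment_compact.
move=> v /= v1 k; case/mxvec_indexP: k => i j.
have vij : (vec_mx v) i j = v 0 (mxvec_index i j) by rewrite mxE.
have : (vec_mx v : 'M[R]_n) i j ^+ 2 <= 1.
  have <- : ((vec_mx v)^T *m vec_mx v) j j = 1 by rewrite v1 mxE eqxx.
  rewrite [leRHS]mxE (bigD1 i) //= [_^T j i]mxE -expr2 lerDl sumr_ge0 // => k _.
  by rewrite [_^T j k]mxE -expr2 sqr_ge0.
by rewrite vij -real_normK ?num_real // expr_le1 //= in_itv /= ler_norml.
Qed.

(** By Gram-Schmidt [res g] is Q M with Q orthogonal and M lower triangular, so the coset of g is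
    that of [emb Q]: G / K is a continuous image of O(3). *)
Lemma hom_space_K_compact : compact [set: hom_space (@G3 R) (G3 `&` Hflag)].
Proof.
pose K : set 'M[R]_4 := G3 `&` Hflag.
have [G1 _ _] := @is_mx_group_G3 R.
pose C := [set v : 'rV[R]_(3 * 3) | (vec_mx v)^T *m vec_mx v = 1%:M].
have uC v : C v -> (vec_mx v : 'M[R]_3) \in unitmx.
  by move=> /mulmx1_unit[].
pose X := euclid 'rV[R]_(3 * 3).
pose s (v : X) : @G3s R := insubd (SigSub (mem_set G1) : G3) (emb (vec_mx v)).
have sE v : C v -> set_val (s v) = emb (vec_mx v).
  by move=> Cv; apply: insubdK; apply: mem_set; apply: G3_emb; exact: uC.
pose h (v : X) : hom_space (@G3 R) K := to_coset K (s v).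
have hC : {within C, continuous h}.
  apply: continuous_in_subspaceT => v /set_mem Cv.
  have sv := smooth_vec_mx (v : X).
  have ss : smoothm_at (v : X) s.
    apply: (@smoothm_at_insub _ (euclid 'M[R]_4) G3 X v _
      (fun w => emb (vec_mx w))).
      apply/(smooth_mx_atP (@comp_closed_euclid _ _)).
      by apply: smooth_mx_emb => //; [exact: comp_closed_euclid|exact: uC].
    by apply: filterS (smooth_mx_unit_near sv (uC _ Cv)) => w; exact: G3_emb.
  have sq := quotient_map_smooth (quotient_map_coset (@G3 R) K).
  by have [] := smoothm_at_comp ss ((smooth_mapP _).1 sq (s v)).
have -> : [set: hom_space (@G3 R) K] = h @` C.
  apply/seteqP; split=> // t _; have [g <-] := cosetsP t.
  have [Q [Q1 lQ]] := orthogonal_lower (GLs_unit (gres g)).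
  have CQ : C (mxvec Q) by rewrite /C /= mxvecK.
  exists (mxvec Q) => //.
  apply/(to_coset_eq (s (mxvec Q)) g (@is_mx_group_K R) (@G3_unit R)).
  apply/(K_cosetP (s (mxvec Q)) g).
  rewrite -[set_val (gres (s _))]/(res (set_val (s (mxvec Q)))) sE // mxvecK res_emb.
  have uQ : Q \in unitmx by case: (mulmx1_unit Q1).
  by rewrite -[invmx Q]mul1mx -Q1 mulmxK.
exact: continuous_compact hC (@orthogonal_compact 3).
Qed.

(** The image of G / K under the projection, whose continuity is tested on G, where it becomes the
    quotient map onto G / L. *)
Lemma hom_space_compact_proj (L : set 'M[R]_4) : is_mx_group L ->
  G3 `&` Hflag `<=` L -> compact [set: hom_space (@G3 R) L].
Proof.
move=> gL KL; pose K : set 'M[R]_4 := G3 `&` Hflag.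
pose p : hom_space (@G3 R) K -> hom_space (@G3 R) L := hom_proj L.
have [qs qo _] := quotient_map_coset (@G3 R) K.
have [_ qo' _] := quotient_map_coset (@G3 R) L.
have pE (g : @G3s R) : p (to_coset K g) = to_coset L g.
  by apply: hom_projE => //; exact: is_mx_group_K.
have cp : continuous p.
  apply/continuousP => U /qo' oU; apply/qo.
  rewrite (_ : _ @^-1` _ = (to_coset L : @G3s R -> hom_space (@G3 R) L) @^-1` U) //.
  by apply/funext => g; rewrite /preimage /= pE.
have -> : [set: hom_space (@G3 R) L] = p @` [set: hom_space (@G3 R) K].
  apply/seteqP; split=> // t _; have [g <-] := cosetsP t.
  by exists (to_coset K g) => //; exact: pE.
apply: continuous_compact; last exact: hom_space_K_compact.
exact: continuous_subspaceT.
Qed.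

End GramSchmidt.

Theorem theorem2 (R : realType) (V : vectType R) (dimV : \dim {:V} = 3%N) :
  let G : set 'M[R]_4 := G3 in
  let K4 := G `&` Hstab 4 in
  let K1 := G `&` Hbar 1 in
  let K := G `&` Hflag in
  let pl : hom_space G K -> hom_space G K4 := hom_proj K4 in
  let pr : hom_space G K -> hom_space G K1 := hom_proj K1 in
  [/\ G = [set g : 'M[R]_4 | SL4 g /\
        (forall i j : 'I_4, (i.+1 == 3%N) != (j.+1 == 3%N) -> g i j = 0)],
      [/\ compact [set: hom_space G K4],
          compact [set: hom_space G K] &
          compact [set: hom_space G K1]],
      [/\ diffeomorphic (hom_space G K4) (RP R 2),
          diffeomorphic (hom_space G K) (flags V) &
          diffeomorphic (hom_space G K1) (RP R 2)],
      diffeomorphic (hom_space K4 K) (circle R) /\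
      (forall x : hom_space G K4,
         diffeomorphic (fiber pl x) (hom_space K4 K)) &
      diffeomorphic (hom_space K1 K) (circle R) /\
      (forall x : hom_space G K1,
         diffeomorphic (fiber pr x) (hom_space K1 K))].
Proof.
move=> G K4 K1 K pl pr; split.
- have E (i : 'I_4) : (i.+1 == 3%N) = (i == o2) by [].
  apply/seteqP; split=> g.
    move=> /G3P[Sg bg]; split=> // i j; rewrite !E.
    have [->|i2] := eqVneq i o2; have [->//|j2] := eqVneq j o2 => // _.
      exact: (bg _ j2).2.
    exact: (bg _ i2).1.
  move=> [Sg bg]; apply/G3P; split=> // k k2.
  by split; apply: bg; rewrite !E eqxx (negbTE k2).
- split; first apply: hom_space_compact_proj.
  + exact: is_mx_group_K4.
  + by rewrite KE; exact: subIsetl.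
  + exact: hom_space_K_compact.
  apply: hom_space_compact_proj; first exact: is_mx_group_K1.
  by rewrite KE; exact: subIsetr.
- split; [exact: hom_space_K4_RP|exact: hom_space_K_flags|exact: hom_space_K1_RP].
- by split; [exact: K4_circle|exact: fiber_K4].
- by split; [exact: K1_circle|exact: fiber_K1].
Qed.
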